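(* Let $\Bbbk$ be an algebraically closed field of characteristic $0$ and let $X\subset\mathbb{P}^N$ be a projectively embedded toric variety over $\Bbbk$. Then there exist disjoint torus invariant closed subvarieties $X_0,\ldots,X_{\delta_\gamma(X)}\subset X$ such that $X$ is the join of $X_0,\ldots,X_{\delta_\gamma(X)}$.
   Context: For a free abelian group $M$ of finite rank, $T_M=\operatorname{Spec}\Bbbk[M]$, where $\Bbbk[M]=\bigoplus_{u\in M}\Bbbk z^u$. For a finite subset $A=\{u_0,\ldots,u_N\}\subset M$ (distinct elements), $X_A\subset\mathbb{P}^N$ is the closure of the image of $T_M\to\mathbb{P}^N$, $t\mapsto[z^{u_0}(t):\cdots:z^{u_N}(t)]$. The torus $T_{\langle A-A\rangle}$, where $\langle A-A\rangle\subset M$ is the subgroup generated by $\{u-u'\mid u,u'\in A\}$, acts on $X_A$ and is contained in it as an open dense orbit; ''torus invariant'' refers to this action. A projective variety $X\subset\mathbb{P}^N$ is called projectively embedded toric if it is projectively equivalent to $X_A$ for some finite subset $A$ of a free abelian group $M$ of finite rank. Here $X_1\subset\mathbb{P}^{N_1}$ and $X_2\subset\mathbb{P}^{N_2}$ are projectively equivalent if there are linear embeddings $\jmath_i:\mathbb{P}^{N_i}\hookrightarrow\mathbb{P}^{N'}$ for some $N'$ with $\jmath_1(X_1)=\jmath_2(X_2)$. The Gauss map of an $n$-dimensional projective variety $X\subset\mathbb{P}^N$ is the rational map $\gamma: X\dashrightarrow\mathbb{G}(n,\mathbb{P}^N)$ sending each smooth point $x$ to the embedded tangent space $\mathbb{T}_xX\subset\mathbb{P}^N$;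 the Gauss defect $\delta_\gamma(X)$ is the dimension of a general fiber of $\gamma$. The join of projective varieties $X_1,\ldots,X_m\subset\mathbb{P}^N$ is the closure of $\bigcup_{x_1\in X_1,\ldots,x_m\in X_m}\Lambda_{x_1,\ldots,x_m}$, where $\Lambda_{x_1,\ldots,x_m}$ is the linear subvariety spanned by $x_1,\ldots,x_m$. *)

(* Defs.v *)
From HB Require Import structures.
From mathcomp Require Import all_boot all_order all_algebra.
From mathcomp Require Import boolp classical_sets.
From mathcomp Require Import mpoly.

Set Implicit Arguments.
Unset Strict Implicit.
Unset Printing Implicit Defensive.

Import GRing.Theory.
Local Open Scope classical_set_scope.
Local Open Scope ring_scope.

(* Varieties over the algebraically closed field k are treated classically,
   through their closed points. A point of P^N is a line of k^(N+1). *)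
Record ppoint (k : fieldType) (N : nat) := PPoint {
  pline : {vspace 'rV[k]_N.+1};
  dim_pline : \dim pline == 1%N }.

(* x = [v_0 : ... : v_N]; since pline x has dimension 1, this forces v != 0. *)
Definition hcoords (k : fieldType) (N : nat) (x : ppoint k N)
    (v : 'rV[k]_N.+1) : Prop :=
  pline x = <[v]>%VS.

Definition homogeneous (k : fieldType) (N : nat) (F : {mpoly k[N.+1]}) : Prop :=
  exists d : nat, F \is d.-homog.

Definition vanishes_at (k : fieldType) (N : nat) (F : {mpoly k[N.+1]})
    (x : ppoint k N) : Prop :=
  forall v, hcoords x v -> F.@[v 0] = 0.

Definition zclosed (k : fieldType) (N : nat) (C : set (ppoint k N)) : Prop :=
  exists2 S : set {mpoly k[N.+1]}, S `<=` @homogeneous k N &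
    C = [set x | forall F, S F -> vanishes_at F x].

Definition zclosure (k : fieldType) (N : nat) (S : set (ppoint k N)) :
    set (ppoint k N) :=
  \bigcap_(C in [set C | zclosed C /\ S `<=` C]) C.

Definition zclosed_in (k : fieldType) (N : nat) (S Z : set (ppoint k N)) : Prop :=
  exists2 C, zclosed C & Z = S `&` C.

Definition zopen_in (k : fieldType) (N : nat) (S U : set (ppoint k N)) : Prop :=
  exists2 C, zclosed C & U = S `\` C.

Definition zirreducible (k : fieldType) (N : nat) (S : set (ppoint k N)) : Prop :=
  S !=set0 /\
  forall Z1 Z2, zclosed_in S Z1 -> zclosed_in S Z2 -> S = Z1 `|` Z2 ->
    S = Z1 \/ S = Z2.

Definition projective_variety (k : fieldType) (N : nat)
    (X : set (ppoint k N)) : Prop :=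
  zclosed X /\ zirreducible X.

(* Z 0 < Z 1 < ... < Z n is a strict chain of irreducible closed subsets of the
   space S. *)
Definition irreducible_chain (k : fieldType) (N : nat) (S : set (ppoint k N))
    (n : nat) (Z : nat -> set (ppoint k N)) : Prop :=
  (forall i : nat, (i <= n)%N -> zclosed_in S (Z i) /\ zirreducible (Z i)) /\
  (forall i : nat, (i < n)%N -> Z i `<` Z i.+1).

(* Krull dimension of the topological space S (a nonempty one, as n >= 0). *)
Definition has_dim (k : fieldType) (N : nat) (S : set (ppoint k N))
    (n : nat) : Prop :=
  (exists Z, irreducible_chain S n Z) /\
  (forall m Z, irreducible_chain S m Z -> (m <= n)%N).

(* T is the linear subspace of k^(N+1) whose projectivization is the embedded
   tangent space T_x X: it is cut out by the differentials at x of the forms in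
   the homogeneous ideal of X. *)
Definition embedded_tangent_space (k : fieldType) (N : nat)
    (X : set (ppoint k N)) (x : ppoint k N) (T : {vspace 'rV[k]_N.+1}) : Prop :=
  forall v : 'rV[k]_N.+1,
    v \in T <->
    (forall F, homogeneous F -> (forall y, X y -> vanishes_at F y) ->
     forall w, hcoords x w -> \sum_(i < N.+1) (mderiv i F).@[w 0] * v 0 i = 0).

(* Graph of the Gauss map: x is a smooth point of X and T, an n-plane of P^N
   with n = dim X, is the embedded tangent space at x. *)
Definition gauss_map (k : fieldType) (N : nat) (X : set (ppoint k N))
    (x : ppoint k N) (T : {vspace 'rV[k]_N.+1}) : Prop :=
  [/\ X x, embedded_tangent_space X x T &
      exists2 n : nat, has_dim X n & \dim T = n.+1].

(* delta is the dimension of the fiber of the Gauss map through x, for all x in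
   a nonempty open subset of X. *)
Definition gauss_defect (k : fieldType) (N : nat) (X : set (ppoint k N))
    (delta : nat) : Prop :=
  exists U, [/\ zopen_in X U, U !=set0 &
    forall x, U x ->
      exists2 T, gauss_map X x T & has_dim [set y | gauss_map X y T] delta].

Definition join (k : fieldType) (N m : nat)
    (Y : 'I_m -> set (ppoint k N)) : set (ppoint k N) :=
  zclosure [set p | exists2 x : 'I_m -> ppoint k N, forall i, Y i (x i) &
                    (pline p <= \sum_(i < m) pline (x i))%VS].

Definition free_of_finite_rank (M : zmodType) : Prop :=
  exists (r : nat) (f : {additive 'rV[int]_r -> M}), bijective f.

(* A k-point of Spec k[H], i.e. a k-algebra morphism k[H] -> k, is a group
   morphism t : H -> k^*, t(u) being the value of z^u. Here H is a subgroup of M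
   and only the values of t on H are relevant (they are nonzero, since
   t u * t (- u) = 1). *)
Definition torus_point (k : fieldType) (M : zmodType) (H : set M)
    (t : M -> k) : Prop :=
  t 0 = 1 /\ forall u v, H u -> H v -> t (u + v) = t u * t v.

(* The subgroup <A - A> of M. *)
Definition diff_subgroup (M : zmodType) (m : nat) (A : 'I_m.+1 -> M) : set M :=
  \bigcap_(H in [set H : set M | [/\ H 0, forall u v, H u -> H v -> H (u - v) &
                                    forall i j, H (A i - A j)]]) H.

(* X_A, for A = {A 0, ..., A m}. *)
Definition toric_X (k : fieldType) (M : zmodType) (m : nat)
    (A : 'I_m.+1 -> M) : set (ppoint k m) :=
  zclosure [set x | exists2 t : M -> k, torus_point setT t &
                    hcoords x (\row_i t (A i))].

(* y = s . x for the action of s in T_<A-A> on P^m; dividing by z^(A 0) puts the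
   exponents in <A - A> and does not change the point. *)
Definition torus_act (k : fieldType) (M : zmodType) (m : nat)
    (A : 'I_m.+1 -> M) (s : M -> k) (x y : ppoint k m) : Prop :=
  exists2 v, hcoords x v & hcoords y (\row_i (s (A i - A ord0) * v 0 i)).

(* The image of Y under the map of projective spaces induced by an
   injective f. *)
Definition pimage (k : fieldType) (N N' : nat)
    (f : 'Hom('rV[k]_N.+1, 'rV[k]_N'.+1)) (Y : set (ppoint k N)) :
    set (ppoint k N') :=
  [set q | exists2 p, Y p & pline q = (f @: pline p)%VS].

(* The data exhibiting X as projectively equivalent to some X_A. *)
Record toric_embedding (k : fieldType) (N : nat) (X : set (ppoint k N)) :=
  ToricEmbedding {
    te_M : zmodType;
    te_free : free_of_finite_rank te_M;
    te_m : nat;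
    te_A : 'I_te_m.+1 -> te_M;
    te_A_inj : injective te_A;
    te_N' : nat;
    te_j1 : 'Hom('rV[k]_N.+1, 'rV[k]_te_N'.+1);
    te_j2 : 'Hom('rV[k]_te_m.+1, 'rV[k]_te_N'.+1);
    te_j1_inj : lker te_j1 == 0%VS;
    te_j2_inj : lker te_j2 == 0%VS;
    te_equiv : pimage te_j1 X = pimage te_j2 (@toric_X k _ _ te_A) }.
Arguments te_A {k N X} _ _.

(* Invariance under T_<A-A>, acting on X through its identification with X_A. *)
Definition torus_invariant (k : fieldType) (N : nat) (X : set (ppoint k N))
    (E : toric_embedding X) (Y : set (ppoint k N)) : Prop :=
  exists Y' : set (ppoint k (te_m E)),
    [/\ Y' `<=` toric_X (te_A E),
        pimage (te_j1 E) Y = pimage (te_j2 E) Y' &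
        forall s, torus_point (diff_subgroup (te_A E)) s ->
        forall x y, Y' x -> torus_act (te_A E) s x y -> Y' y].

(* Main.v *)
Require Import Defs.
From HB Require Import structures.
From mathcomp Require Import all_boot all_order all_algebra.
From mathcomp Require Import boolp classical_sets.
From mathcomp Require Import mpoly.
From mathcomp Require Import ring zify.

(** The theorem is proved by exhibiting the pieces of [X_A] that correspond to
    the connected components of the matroid of the vectors [(1, A i)].

    Put [a ~ b] for two exponents of the same degree with the same weight
    [sum a_i A_i]. Over a field of characteristic zero, [X_A] is the set of the
    points at which [z^a = z^b] for all [a ~ b] ([toric_X_E]): a form that
    vanishes on the torus has zero sum of coefficients in each class, as one sees
    on a one-parameter subgroup that separates the weights ([toric_sums]). The
    same argument shows that the closure of each orbit considered below is
    irreducible ([toric_prime]).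

    Let [W] be the span of the rows of the matrix with columns [(1, A i)], that
    is, the annihilator of the relations [a - b]. The tangent space at a point
    [y] of the cone over [X_A] contains the entrywise product [y W]
    ([tangent_orbit]) and is equal to it if [y] has no zero coordinate
    ([tangent_torus]). So a point [y] has the same tangent space as a point [x] of
    the torus only if the diagonal matrix [y / x] preserves [W]. The diagonal
    matrices that preserve [W] are a subalgebra of [k^I], so they are the
    functions that are constant on the blocks of a partition of [I]
    ([multiplier_block]). If there are [d + 1] blocks, then the general fiber of
    the Gauss map lies between a linear subspace of dimension [d] and the part of
    it where no coordinate vanishes. Its Krull dimension is [d], hence the Gauss
    defect is [d] ([gauss_fiber_dim]). Here the lower bound comes from a flag
    ([flag_chain]); for the upper bound, a longer chain of irreducible closed sets
    would provide more linearly independent forms of some degree than there are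
    monomials ([chain_bound]).

    On the other hand, the indicators of the blocks preserve [W]; by duality each
    relation between the elements of [A] is the sum of its restrictions to the
    blocks, and these are again relations ([toric_eqv_restr]). Characteristic zero
    is used here to go back from [k] to the integers. Therefore a vector
    satisfies the binomial equations of [X_A] if and only if its restrictions to
    the blocks do ([toric_cone_restr], [toric_cone_glue]), which says that [X_A] is
    the join of the [d + 1] subvarieties where all coordinates outside one block
    vanish ([join_pieces]).

    Finally, [X_A] spans its ambient space because distinct characters are
    linearly independent, so that [X] is the image of [X_A] under an injective
    linear map [g] ([embedding_factor]) and everything is transported along [g]. *)

Set Implicit Arguments.
Unset Strict Implicit.
Unset Printing Implicit Defensive.

Import GRing.Theory.
Local Open Scope classical_set_scope.
Local Open Scope ring_scope.

(** * Forms and their directional derivatives *)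

Section Polynomials.
Variables (k : fieldType) (n : nat).
Implicit Types (F G : {mpoly k[n]}) (v w : 'rV[k]_n).

Lemma mpoly_ring_ind (P : {mpoly k[n]} -> Prop) :
  (forall c, P c%:MP) -> (forall i, P 'X_i) ->
  (forall F G, P F -> P G -> P (F + G)) ->
  (forall F G, P F -> P G -> P (F * G)) -> forall F, P F.
Proof.
move=> PC PX PD PM F; have P1 : P 1 by rewrite -mpolyC1.
elim/mpolyind: F => [|c m F _ _ PF]; first by rewrite -mpolyC0.
apply: (PD) => //; rewrite -mul_mpolyC; apply: (PM) => //.
rewrite mpolyXE_id; elim/big_ind: _ => // i _.
by elim: (m i) => [|e IH]; rewrite ?expr0 // exprS; apply: (PM).
Qed.

Lemma homog_scale F d a v : F \is d.-homog ->
  F.@[(a *: v) 0] = a ^+ d * F.@[v 0].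
Proof.
move=> /dhomogP hF; rewrite !mevalE mulr_sumr !big_seq; apply: eq_bigr => m /hF /= md.
have {md} <- : mdeg m = d by [].
rewrite mulrCA; congr (_ * _); rewrite mdegE -prodrXr -big_split /=.
by apply: eq_bigr => i _; rewrite mxE exprMn.
Qed.

Definition dirder F w v : k := \sum_(i < n) F^`M(i).@[w 0] * v 0 i.

Lemma dirderC c w v : dirder c%:MP w v = 0.
Proof. by rewrite /dirder big1 // => i _; rewrite mderivC meval0 mul0r. Qed.

Lemma dirderXU i w v : dirder 'X_i w v = v 0 i.
Proof.
rewrite /dirder (bigD1 i) //= big1 => [|j ji].
  by rewrite mderivX mnm1E eqxx scale1r
    mevalX big1 ?mul1r ?addr0 // => j _; rewrite mnmBE subnn expr0.
by rewrite mderivX mnm1E eq_sym (negbTE ji) scale0r meval0 mul0r.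
Qed.

Lemma dirderD F G w v : dirder (F + G) w v = dirder F w v + dirder G w v.
Proof.
by rewrite /dirder -big_split; apply: eq_bigr => i _; rewrite mderivD mevalD mulrDl.
Qed.

Lemma dirderN F w v : dirder (- F) w v = - dirder F w v.
Proof.
by rewrite /dirder -sumrN; apply: eq_bigr => i _; rewrite mderivN mevalN mulNr.
Qed.

Lemma dirderM F G w v :
  dirder (F * G) w v = dirder F w v * G.@[w 0] + F.@[w 0] * dirder G w v.
Proof.
rewrite /dirder mulr_suml mulr_sumr -big_split; apply: eq_bigr => i _ /=.
by rewrite mderivM mevalD !mevalM; ring.
Qed.

Lemma dirderZ c F w v : dirder (c *: F) w v = c * dirder F w v.
Proof. by rewrite -mul_mpolyC dirderM dirderC mevalC mul0r add0r. Qed.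

(** The torus acts diagonally, so that a vector tangent to an orbit at [y] is
    the entrywise product of [y] with a vector [w]; along it each monomial is
    an eigenvector. *)
Lemma dirder_monomial (a : 'X_{1..n}) (y w : 'rV[k]_n) :
  dirder 'X_[a] y (\row_i (y 0 i * w 0 i)) =
  (\prod_i y 0 i ^+ a i) * \sum_i w 0 i *+ a i.
Proof.
rewrite /dirder mulr_sumr; apply: eq_bigr => i _.
rewrite mderivX mevalZ mevalX mxE.
have [ai0|ai0] := eqVneq (a i) 0%N; first by rewrite ai0 mulr0n !mul0r mulr0.
rewrite (bigD1 i) //= [X in _ = X * _](bigD1 i) //= !mnmBE mnm1E eqxx.
have -> : \prod_(j < n | j != i) y 0 j ^+ (a - U_(i))%MM j =
          \prod_(j < n | j != i) y 0 j ^+ a j.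
  by apply: eq_bigr => j ji; rewrite mnmBE mnm1E eq_sym (negbTE ji) subn0.
rewrite -[w 0 i *+ _]mulr_natr; set P := \prod_(j < n | _) _.
case: (a i) ai0 => // e _; rewrite subn1 /= exprSr; ring.
Qed.

Lemma dirder_sum (I : Type) (r : seq I) (Q : I -> {mpoly k[n]}) w v :
  dirder (\sum_(i <- r) Q i) w v = \sum_(i <- r) dirder (Q i) w v.
Proof.
elim: r => [|x r IH]; first by rewrite !big_nil -mpolyC0 dirderC.
by rewrite !big_cons dirderD IH.
Qed.

Lemma dirder_orbit F (y w : 'rV[k]_n) :
  dirder F y (\row_i (y 0 i * w 0 i)) =
  \sum_(a <- msupp F) F@_a * ((\prod_i y 0 i ^+ a i) * \sum_i w 0 i *+ a i).
Proof.
rewrite {1}[F]mpolyE dirder_sum; apply: eq_bigr => a _.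
by rewrite dirderZ dirder_monomial.
Qed.

End Polynomials.

Section Pullback.
Variables (k : fieldType) (n p : nat) (u : 'Hom('rV[k]_n, 'rV[k]_p)).
Implicit Types (v w : 'rV[k]_n).

Definition lin_form (i : 'I_p) : {mpoly k[n]} :=
  \sum_(j < n) u (delta_mx 0 j) 0 i *: 'X_j.

Lemma lfun_row v i : u v 0 i = \sum_(j < n) v 0 j * u (delta_mx 0 j) 0 i.
Proof.
rewrite [in LHS](row_sum_delta v) linear_sum summxE; apply: eq_bigr => j _.
by rewrite linearZ mxE.
Qed.

Lemma lin_formE i v : (lin_form i).@[v 0] = u v 0 i.
Proof.
rewrite lfun_row raddf_sum; apply: eq_bigr => j _.
by rewrite /= mevalZ mevalXU mulrC.
Qed.

Lemma lin_form_homog i : lin_form i \is 1.-homog.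
Proof.
by apply: rpred_sum => j _; rewrite rpredZ // dhomogX /= mdeg1.
Qed.

Lemma dirder_lin_form i w v : dirder (lin_form i) w v = u v 0 i.
Proof.
rewrite lfun_row dirder_sum; apply: eq_bigr => j _.
by rewrite dirderZ dirderXU mulrC.
Qed.

Definition pullback (F : {mpoly k[p]}) : {mpoly k[n]} :=
  F \mPo [tuple lin_form i | i < p].

Lemma pullbackE F v : (pullback F).@[v 0] = F.@[u v 0].
Proof.
by rewrite comp_mpoly_meval; apply: meval_eq => i; rewrite tnth_mktuple lin_formE.
Qed.

Lemma pullback_homog F d : F \is d.-homog -> pullback F \is d.-homog.
Proof.
move=> /dhomogP hF; rewrite /pullback comp_mpolyE big_seq.
apply: rpred_sum => m /hF /= md; have {md} <- : mdeg m = d by [].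
rewrite rpredZ //= mdegE; elim/big_rec2: _ => [|i e G _ hG]; first exact: dhomog1.
rewrite tnth_mktuple; apply: dhomogM => //.
by rewrite -[X in X.-homog]mul1n dhomogMn // lin_form_homog.
Qed.

Lemma dirder_pullback F w v : dirder (pullback F) w v = dirder F (u w) (u v).
Proof.
rewrite /pullback; elim/mpoly_ring_ind: F => [c|i|F G hF hG|F G hF hG].
- by rewrite comp_mpolyC !dirderC.
- by rewrite comp_mpolyXU -tnth_nth tnth_mktuple dirder_lin_form dirderXU.
- by rewrite rmorphD !dirderD hF hG.
- by rewrite rmorphM !dirderM hF hG -!pullbackE.
Qed.

End Pullback.

(** * Points, closed sets and irreducibility *)

Section Points.
Variables (k : fieldType) (N : nat).
Implicit Types (x y : ppoint k N) (v w : 'rV[k]_N.+1).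

Lemma ppoint_inj x y : pline x = pline y -> x = y.
Proof.
case: x y => [l hl] [l' hl'] /= E; case: _ / E in hl' *.
by rewrite (bool_irrelevance hl hl').
Qed.

Lemma ppt_subproof v : v != 0 -> \dim <[v]>%VS == 1%N.
Proof. by move=> v0; rewrite dim_vline v0. Qed.

Definition ppt v (v0 : v != 0) : ppoint k N := PPoint (ppt_subproof v0).

Lemma hcoords_ppt v (v0 : v != 0) : hcoords (ppt v0) v.
Proof. by []. Qed.

Lemma hcoords_neq0 x v : hcoords x v -> v != 0.
Proof.
move=> xv; apply/eqP => v0; have := dim_pline x.
by rewrite xv v0 dim_vline eqxx.
Qed.

Lemma hcoords_ex x : exists v, hcoords x v.
Proof.
exists (vpick (pline x)); apply/eqP; rewrite eq_sym eqEdim -memvE memv_pick.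
by rewrite dim_vline vpick0 (eqP (dim_pline x)) -dimv_eq0 (eqP (dim_pline x)).
Qed.

Lemma hcoordsZ x v a : a != 0 -> hcoords x v -> hcoords x (a *: v).
Proof.
move=> a0 xv; rewrite /hcoords xv; apply/eqP; rewrite eqEsubv -!memvE; apply/andP; split.
  by apply/vlineP; exists a^-1; rewrite scalerA mulVf ?scale1r.
by apply/vlineP; exists a.
Qed.

Lemma hcoords_uniq x v w : hcoords x v -> hcoords x w ->
  exists2 a, a != 0 & w = a *: v.
Proof.
move=> xv xw; have : w \in <[v]>%VS by rewrite -xv xw memv_line.
case/vlineP => a wE; exists a => //; apply: contraNneq (hcoords_neq0 xw) => a0.
by rewrite wE a0 scale0r.
Qed.

Lemma hcoords_inj x y v : hcoords x v -> hcoords y v -> x = y.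
Proof. by move=> xv yv; apply: ppoint_inj; rewrite xv yv. Qed.

Lemma vanishesE (F : {mpoly k[N.+1]}) x v : homogeneous F -> hcoords x v ->
  vanishes_at F x <-> F.@[v 0] = 0.
Proof.
move=> [d hF] xv; split=> [/(_ _ xv) //|Fv w xw].
by have [a _ ->] := hcoords_uniq xv xw; rewrite (homog_scale _ _ hF) Fv mulr0.
Qed.

Lemma homogeneousM (F G : {mpoly k[N.+1]}) :
  homogeneous F -> homogeneous G -> homogeneous (F * G).
Proof. by move=> [d hF] [e hG]; exists (d + e)%N; apply: dhomogM. Qed.

Lemma homogeneous_pullback N' (u : 'Hom('rV[k]_N.+1, 'rV[k]_N'.+1)) F :
  homogeneous F -> homogeneous (pullback u F).
Proof. by move=> [d hF]; exists d; apply: pullback_homog. Qed.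

Lemma vanishes_atM (F G : {mpoly k[N.+1]}) x : homogeneous F -> homogeneous G ->
  vanishes_at (F * G) x <-> vanishes_at F x \/ vanishes_at G x.
Proof.
move=> hF hG; have [v xv] := hcoords_ex x.
rewrite (vanishesE (homogeneousM hF hG) xv) (vanishesE hF xv) (vanishesE hG xv).
rewrite mevalM; split=> [/eqP|[] ->]; rewrite ?mul0r ?mulr0 //.
by rewrite mulf_eq0 => /orP[] /eqP ->; [left|right].
Qed.

Lemma zclosedI (C D : set (ppoint k N)) :
  zclosed C -> zclosed D -> zclosed (C `&` D).
Proof.
move=> [S hS ->] [T hT ->]; exists (S `|` T).
  by move=> F [/hS|/hT].
apply/seteqP; split=> x /=.
  by move=> [xS xT] F [/xS|/xT].
by move=> xST; split=> F FS; apply: xST; [left|right].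
Qed.

Lemma zclosed_form (F : {mpoly k[N.+1]}) : homogeneous F ->
  zclosed [set x | vanishes_at F x].
Proof.
move=> hF; exists [set F]; first by move=> G ->.
by apply/seteqP; split=> x /=; [move=> xF G ->|apply].
Qed.

Lemma zclosed_zclosure (S : set (ppoint k N)) : zclosed (zclosure S).
Proof.
exists [set F | homogeneous F /\ forall x, S x -> vanishes_at F x].
  by move=> F [].
apply/seteqP; split=> x.
  move=> xS F [hF SF]; apply: (xS _); split; first exact: zclosed_form.
  by move=> y /SF.
move=> /= xF _ [[T hT ->] ST] F TF; apply: xF; split; first exact: hT.
by move=> y /ST; apply.
Qed.

Lemma subset_zclosure (S : set (ppoint k N)) : S `<=` zclosure S.
Proof. by move=> x Sx C [_]; apply. Qed.

Lemma zclosure_sub (S C : set (ppoint k N)) : zclosed C -> S `<=` C -> zclosure S `<=` C.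
Proof. by move=> cC SC x; apply. Qed.

Lemma zclosed_proper (C D : set (ppoint k N)) : zclosed C -> ~ D `<=` C ->
  exists2 F, homogeneous F &
    (forall x, C x -> vanishes_at F x) /\ exists2 x, D x & ~ vanishes_at F x.
Proof.
move=> [S hS ->] /existsNP[x /not_implyP[Dx /existsNP[F /not_implyP[SF nF]]]].
exists F; first exact: hS.
by split; [move=> y; apply|exists x].
Qed.

(** Irreducibility means that the homogeneous ideal is prime. *)
Lemma zirreducibleP (S : set (ppoint k N)) :
  zirreducible S <-> S !=set0 /\ forall F G, homogeneous F -> homogeneous G ->
    (forall x, S x -> vanishes_at (F * G) x) ->
    (forall x, S x -> vanishes_at F x) \/ (forall x, S x -> vanishes_at G x).
Proof.
split=> [[S0 irr]|[S0 pr]]; split=> //.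
  move=> F G hF hG FG.
  case: (irr (S `&` [set x | vanishes_at F x]) (S `&` [set x | vanishes_at G x])).
  - by exists [set x | vanishes_at F x] => //; apply: zclosed_form.
  - by exists [set x | vanishes_at G x] => //; apply: zclosed_form.
  - apply/seteqP; split=> x /=; last by case=> -[].
    by move=> Sx; have /(vanishes_atM _ hF hG)[] := FG _ Sx; [left|right].
  - by move=> SE; left => x; rewrite SE => -[].
  - by move=> SE; right => x; rewrite SE => -[].
move=> _ _ [C cC ->] [D cD ->] SE; apply: contrapT => /not_orP[nC nD].
have [|F hF [CF [x Sx Fx]]] := @zclosed_proper C S cC.
  by move=> SC; apply: nC; apply/seteqP; split=> x; [split=> //; apply: SC|case].
have [|G hG [DG [y Sy Gy]]] := @zclosed_proper D S cD.
  by move=> SD; apply: nD; apply/seteqP; split=> z; [split=> //; apply: SD|case].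
case: (pr F G hF hG) => [z|/(_ _ Sx) //|/(_ _ Sy) //].
rewrite SE => -[] [_ zC]; apply/(vanishes_atM _ hF hG); [left|right].
  exact: CF.
exact: DG.
Qed.

End Points.

(** * Linear maps of projective spaces *)

Section LinearImage.
Variable (k : fieldType).

(** The equations of a linear subspace are the coordinates of the projection
    onto a complement. *)
Definition equations N (V : {vspace 'rV[k]_N.+1}) : 'Hom('rV[k]_N.+1, 'rV[k]_N.+1) :=
  (\1 - projv V)%VF.

Lemma equationsP N (V : {vspace 'rV[k]_N.+1}) v : v \in V <-> equations V v = 0.
Proof.
rewrite /equations add_lfunE opp_lfunE id_lfunE; split=> [vV|/subr0_eq ->].
  by rewrite projv_id // subrr.
exact: memv_proj.
Qed.

Lemma zclosed_linear N (V : {vspace 'rV[k]_N.+1}) :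
  zclosed [set x : ppoint k N | (pline x <= V)%VS].
Proof.
exists [set F | exists i, F = lin_form (equations V) i].
  by move=> _ [i ->]; exists 1%N; apply: lin_form_homog.
have hom i : homogeneous (lin_form (equations V) i).
  by exists 1%N; apply: lin_form_homog.
apply/seteqP; split=> x /=; have [v xv] := hcoords_ex x; rewrite {1}xv -memvE.
  by move=> /equationsP vV _ [i ->]; rewrite (vanishesE (hom i) xv) lin_formE vV mxE.
move=> xF; apply/equationsP/rowP => i; rewrite mxE -lin_formE.
by apply/(vanishesE (hom i) xv); apply: xF; exists i.
Qed.

Variables (N N' : nat) (g : 'Hom('rV[k]_N.+1, 'rV[k]_N'.+1)).
Hypothesis g_inj : lker g == 0%VS.

Lemma inj_neq0 v : v != 0 -> g v != 0.
Proof. by rewrite -(linear0 g) (inj_eq (lker0P g_inj)). Qed.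

Lemma hcoords_image x y v : hcoords x v -> pline y = (g @: pline x)%VS -> hcoords y (g v).
Proof. by move=> xv yE; rewrite /hcoords yE xv limg_line. Qed.

Lemma pimageP (Y : set (ppoint k N)) q :
  pimage g Y q <-> exists x v, [/\ Y x, hcoords x v & hcoords q (g v)].
Proof.
split=> [[x Yx qE]|[x [v [Yx xv qv]]]].
  by have [v xv] := hcoords_ex x; exists x, v; split=> //; apply: hcoords_image xv qE.
by exists x => //; rewrite qv xv limg_line.
Qed.

Lemma retractK v : (g^-1)%VF (g v) = v.
Proof. exact: lker0_lfunK. Qed.

Lemma zclosed_pimage (C : set (ppoint k N)) : zclosed C -> zclosed (pimage g C).
Proof.
move=> [S hS ->].
have -> : pimage g [set x | forall F, S F -> vanishes_at F x] =
    [set y : ppoint k N' | (pline y <= limg g)%VS] `&`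
    [set y | forall F, [set pullback g^-1%VF G | G in S] F -> vanishes_at F y].
  apply/seteqP; split=> y /=.
    move=> /pimageP[x [v [Sx xv yv]]]; split.
      by rewrite yv -memvE memv_img // memvf.
    move=> _ [F SF <-]; have hF := hS _ SF.
    rewrite (vanishesE (homogeneous_pullback _ hF) yv) pullbackE retractK.
    by rewrite -(vanishesE hF xv); apply: Sx.
  move=> [yg yS]; have [w yw] := hcoords_ex y.
  have /memv_imgP[v _ wE] : w \in limg g by rewrite memvE -yw.
  have v0 : v != 0.
    by apply: contraNneq (hcoords_neq0 yw) => v0; rewrite wE v0 linear0.
  apply/pimageP; exists (ppt v0), v; split=> //; last by rewrite -wE.
  move=> F SF; have hF := hS _ SF.
  rewrite (vanishesE hF (hcoords_ppt v0)) -[v]retractK -wE -pullbackE.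
  by rewrite -(vanishesE (homogeneous_pullback _ hF) yw); apply: yS; exists F.
apply: zclosedI; first exact: zclosed_linear.
by exists [set pullback g^-1%VF G | G in S] => // _ [F /hS hF <-]; apply: homogeneous_pullback.
Qed.

Lemma zclosed_preimage (C : set (ppoint k N')) : zclosed C ->
  zclosed [set x : ppoint k N | forall y v, hcoords x v -> hcoords y (g v) -> C y].
Proof.
move=> [S hS ->]; exists [set pullback g G | G in S].
  by move=> _ [F /hS hF <-]; apply: homogeneous_pullback.
apply/seteqP; split=> x /=; have [v xv] := hcoords_ex x.
  have gv0 : g v != 0 by rewrite inj_neq0 // (hcoords_neq0 xv).
  move=> xC _ [F SF <-]; have hF := hS _ SF.
  rewrite (vanishesE (homogeneous_pullback _ hF) xv) pullbackE.
  rewrite -(vanishesE hF (hcoords_ppt gv0)); exact: (xC _ v).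
move=> xS y w xw yw F SF; have hF := hS _ SF.
rewrite (vanishesE hF yw) -pullbackE.
by rewrite -(vanishesE (homogeneous_pullback _ hF) xw); apply: xS; exists F.
Qed.

End LinearImage.

(** * The binomial equations of a toric variety *)

Lemma poly_nonroot (R : idomainType) (f : {poly R}) :
  [pchar R] =i pred0 -> f != 0 -> exists n, n.+1%:R != 0 :> R /\ f.[n.+1%:R] != 0.
Proof.
move=> /pcharf0P R0 f0; apply: contrapT => /forallNP nr.
pose s := [seq n.+1%:R : R | n <- iota 0 (size f)].
have : (size s < size f)%N.
  apply: max_poly_roots => //.
    apply/allP => _ /mapP[n _ ->]; apply/negPn/negP => fn.
    by apply: (nr n); split=> //; rewrite R0.
  rewrite map_inj_in_uniq ?iota_uniq // => a b _ _ /eqP ab.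
  wlog le_ab : a b ab / (a <= b)%N.
    by move=> W; case: (leqP a b) => [|/ltnW] h; [exact: W|rewrite (W b a) // eq_sym].
  move: ab; rewrite eq_sym -subr_eq0 -natrB // R0 subSS subn_eq0 => ba.
  by apply/eqP; rewrite eqn_leq le_ab.
by rewrite size_map size_iota ltnn.
Qed.

(** Finitely many nonzero elements of a lattice are separated from [0] by one
    linear form, obtained by evaluating at an integer the polynomials whose
    coefficients are their coordinates. *)
Lemma separating_form (M : zmodType) (Q : seq M) : free_of_finite_rank M ->
  exists lam : {additive M -> int}, {in Q, forall u, lam u = 0 -> u = 0}.
Proof.
move=> [r [f [h fK hK]]].
have hB u v : h (u - v) = h u - h v by apply: (can_inj fK); rewrite hK raddfB !hK.
pose p u : {poly int} := \poly_(i < r) (if insub i is Some j then h u 0 j else 0).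
have pB u v : p (u - v) = p u - p v.
  apply/polyP => i; rewrite coefB !coef_poly; have [ir|ir] := ltnP i r; last by rewrite subr0.
  by case: insubP => [j _ _|_]; rewrite ?subr0 // hB !mxE.
have p0 u : p u = 0 -> u = 0.
  move=> /polyP pu; rewrite -[u]hK; have -> : h u = 0; last by rewrite raddf0.
  apply/rowP => i; have := pu i; rewrite coef_poly ltn_ord coef0 mxE.
  by case: insubP => [j _ ji|]; [rewrite (_ : j = i) //; apply: val_inj|rewrite ltn_ord].
have prod0 : \prod_(u <- Q | p u != 0) p u != 0.
  by rewrite prodf_seq_neq0; apply/allP => u _; apply/implyP.
have [n [_ nE]] := poly_nonroot (@Num.Theory.pchar_num int) prod0.
(* The value of the polynomial at a common non-root is additive in [u]. *)
pose lam u : int := (p u).[n.+1%:R].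
have lamB : zmod_morphism lam by move=> u v; rewrite /lam pB hornerD hornerN.
pose L : {additive M -> int} :=
  HB.pack lam (GRing.isZmodMorphism.Build M int lam lamB).
exists L => u uQ Lu; apply: p0; apply/eqP; apply: contraNT nE => pu0.
rewrite horner_prod big_seq_cond prodf_seq_eq0; apply/hasP; exists u => //.
by rewrite uQ pu0; apply/eqP.
Qed.

Section Toric.
Variables (k : fieldType) (k0 : [pchar k] =i pred0).
Variables (M : zmodType) (M_free : free_of_finite_rank M).
Variables (m : nat) (A : 'I_m.+1 -> M).
Implicit Types (a b : 'X_{1..m.+1}) (v w y z : 'rV[k]_m.+1) (c : pred 'I_m.+1).

Definition weight a : M := \sum_i A i *+ a i.

(** [a] and [b] are the exponents of a binomial in the ideal of [X_A]. *)
Definition toric_eqv a b : Prop := mdeg a = mdeg b /\ weight a = weight b.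

Definition mon v a : k := \prod_i v 0 i ^+ a i.

Definition torus_vec c (t : M -> k) : 'rV[k]_m.+1 :=
  \row_i (if c i then t (A i) else 0).

Definition supp_in c a := [forall i, c i || (a i == 0%N)].

Definition toric_invariant (phi : 'X_{1..m.+1} -> k) :=
  forall a b, toric_eqv a b -> phi a = phi b.

Lemma sum_of_poly (s : seq 'X_{1..m.+1}) (F phi : 'X_{1..m.+1} -> k)
    (wt : 'X_{1..m.+1} -> nat) :
  {in s &, forall a b, wt a = wt b -> phi a = phi b} ->
  \sum_(a <- s) F a *: 'X^(wt a) = 0 :> {poly k} ->
  \sum_(a <- s) F a * phi a = 0.
Proof.
move=> phiE f0; pose Phi j := phi (nth 0%MM s (find [pred a | wt a == j] s)).
have PhiE a : a \in s -> phi a = Phi (wt a).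
  move=> sa; have hs : has [pred b | wt b == wt a] s by apply/hasP; exists a => //=.
  by apply: phiE => //; [rewrite mem_nth -?has_find|have /eqP := nth_find 0%MM hs].
pose B := (\sum_(a <- s) wt a).+1.
have wtB a : a \in s -> (wt a < B)%N.
  by move=> sa; rewrite ltnS (big_rem a) //= leq_addr.
transitivity (\sum_(j < B) (\sum_(a <- s) F a *: 'X^(wt a) : {poly k})`_j * Phi j).
  under [RHS]eq_bigr => j _ do rewrite coef_sum mulr_suml.
  rewrite exchange_big big_seq [RHS]big_seq; apply: eq_bigr => a sa.
  rewrite (bigD1 (Ordinal (wtB _ sa))) //= big1 => [|j ja].
    by rewrite coefZ coefXn eqxx mulr1 addr0 PhiE.
  by rewrite coefZ coefXn (_ : (_ == _) = false) ?mulr0 ?mul0r //; apply/negbTE.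
by rewrite f0; apply: big1 => j _; rewrite coef0 mul0r.
Qed.

Lemma mon_torus c (x : 'I_m.+1 -> k) a :
  \prod_i (if c i then x i else 0) ^+ a i =
  if supp_in c a then \prod_i x i ^+ a i else 0.
Proof.
case: ifP => [/forallP ca|/negbT].
  apply: eq_bigr => i _; have := ca i; case: (c i) => //= /eqP ->.
  by rewrite !expr0.
rewrite negb_forall => /existsP[i]; rewrite negb_or => /andP[/negbTE ci ai].
by rewrite (bigD1 i) //= ci expr0n (negbTE ai) mul0r.
Qed.

(** Restricting to a one-parameter subgroup that separates the weights of the
    monomials of [F] and [G] turns these into polynomials in one variable,
    whose coefficients are the sums of the coefficients of [F] and [G] over the
    monomials of given weight. *)
Lemma toric_sums (F G : {mpoly k[m.+1]}) c phi psi :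
  homogeneous F -> homogeneous G -> toric_invariant phi -> toric_invariant psi ->
  (forall t, torus_point setT t -> (F * G).@[torus_vec c t 0] = 0) ->
  \sum_(a <- msupp F | supp_in c a) F@_a * phi a = 0 \/
  \sum_(a <- msupp G | supp_in c a) G@_a * psi a = 0.
Proof.
move=> [d hF] [e hG] phiI psiI FG0.
pose s := msupp F ++ msupp G.
have [lam lam0] := separating_form [seq weight a - weight b | a <- s, b <- s] M_free.
(* A translation by [K] makes the exponents of the parameter nonnegative; it
   does not change the point of projective space. *)
pose K := (\sum_i `|lam (A i)|)%N.
pose n i := `|(lam (A i) + K%:Z)%R|%N.
have nE i : (n i)%:Z = lam (A i) + K%:Z.
  rewrite /n gez0_abs //.
  have : (`|lam (A i)| <= K)%N by rewrite /K (bigD1 i) //= leq_addr.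
  lia.
pose wt a := (\sum_i n i * a i)%N.
have wtE a : (wt a)%:Z = lam (weight a) + (K * mdeg a)%:Z.
  rewrite /wt /weight mdegE (raddf_sum lam) big_distrr !raddf_sum -big_split.
  by apply: eq_bigr => i _; rewrite /= !PoszM nE raddfMn /= mulrDl -mulr_natr natz.
have wtI (H : {mpoly k[m.+1]}) h phi' : H \is h.-homog -> toric_invariant phi' ->
    {subset msupp H <= s} ->
    {in [seq a <- msupp H | supp_in c a] &, forall a b, wt a = wt b -> phi' a = phi' b}.
  move=> /dhomogP hH I Hs a b; rewrite !mem_filter => /andP[_ Ha] /andP[_ Hb] wab.
  have Eab : mdeg a = mdeg b.
    by transitivity h; [exact: (hH a)|apply/esym; exact: (hH b)].
  apply: I; split=> //; apply/subr0_eq/lam0.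
    by apply/allpairsP; exists (a, b); rewrite !Hs.
  rewrite raddfB; apply/eqP; rewrite subr_eq0 -(inj_eq (addIr (K * mdeg a)%:Z)) /=.
  by rewrite -wtE wab wtE Eab.
pose f (H : {mpoly k[m.+1]}) : {poly k} :=
  \sum_(a <- [seq a <- msupp H | supp_in c a]) H@_a *: 'X^(wt a).
have fE H tau : (f H).[tau] = H.@[(\row_i (if c i then tau ^+ n i else 0)) 0].
  rewrite mevalE /f big_filter horner_sum big_mkcond /=; apply: eq_bigr => a _.
  under eq_bigr do rewrite mxE.
  rewrite mon_torus; case: ifP => _; last by rewrite mulr0.
  rewrite hornerZ hornerXn; congr (_ * _).
  by rewrite /wt -prodrXr; apply: eq_bigr => i _; rewrite exprM.
have [fg0|fg0] := eqVneq (f F * f G) 0.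
  move/eqP: fg0; rewrite mulf_eq0 => /orP[] /eqP f0; [left|right];
    rewrite -big_filter; apply: (sum_of_poly _ f0).
  - by apply: (wtI _ _ _ hF) => // a; rewrite mem_cat => ->.
  - by apply: (wtI _ _ _ hG) => // a; rewrite mem_cat => ->; rewrite orbT.
have [r [r0]] := poly_nonroot k0 fg0; set tau := r.+1%:R => /negP[]; apply/eqP.
rewrite hornerM !fE -mevalM.
pose t u := tau ^ (lam u).
have -> : \row_i (if c i then tau ^+ n i else 0) = tau ^+ K *: torus_vec c t.
  apply/rowP => i; rewrite !mxE; case: (c i); last by rewrite mulr0.
  by rewrite /t -[tau ^+ K]/(tau ^ K%:Z) -expfzDr // addrC -nE.
rewrite (homog_scale _ _ (dhomogM hF hG)) FG0 ?mulr0 //.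
by split=> [|u v _ _]; rewrite /t ?raddf0 ?expr0z // raddfD expfzDr.
Qed.

Definition toric_cone c v : Prop :=
  (forall i, ~~ c i -> v 0 i = 0) /\ toric_invariant (mon v).

Lemma mon_cone0 c v a : (forall i, ~~ c i -> v 0 i = 0) -> ~~ supp_in c a -> mon v a = 0.
Proof.
move=> vc; rewrite negb_forall => /existsP[i]; rewrite negb_or => /andP[ci ai].
by rewrite /mon (bigD1 i) //= vc // expr0n (negbTE ai) mul0r.
Qed.

Lemma meval_cone c v (F : {mpoly k[m.+1]}) : (forall i, ~~ c i -> v 0 i = 0) ->
  F.@[v 0] = \sum_(a <- msupp F | supp_in c a) F@_a * mon v a.
Proof.
move=> vc; rewrite mevalE [RHS]big_mkcond; apply: eq_bigr => a _ /=.
by case: ifPn => // ca; rewrite -/(mon v a) (mon_cone0 vc ca) mulr0.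
Qed.

(** The value of a form at a point of [toric_cone c] is a combination of its sums
    of coefficients over the classes of monomials. With [G = 1] the conclusion is
    that every form which vanishes on the orbit vanishes on the set cut out by
    the binomials; in general, it is that the closure of the orbit is
    irreducible. *)
Lemma toric_prime (F G : {mpoly k[m.+1]}) c :
  homogeneous F -> homogeneous G ->
  (forall t, torus_point setT t -> (F * G).@[torus_vec c t 0] = 0) ->
  (forall v, toric_cone c v -> F.@[v 0] = 0) \/
  (forall v, toric_cone c v -> G.@[v 0] = 0).
Proof.
move=> hF hG FG0; apply: contrapT => /not_orP[].
move=> /existsNP[v /not_implyP[[vc vI] Fv]] /existsNP[w /not_implyP[[wc wI] Gw]].
have := toric_sums hF hG vI wI FG0; rewrite -!meval_cone //.
by case.
Qed.

Lemma homogeneous1 : homogeneous (1 : {mpoly k[m.+1]}).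
Proof. by exists 0%N; apply: dhomog1. Qed.

(** This will be used with the derivatives of the monomials along an orbit, and
    with the indicator of a monomial that is alone in its class. *)
Lemma toric_vanish (F : {mpoly k[m.+1]}) phi : homogeneous F ->
  (forall t, torus_point setT t -> F.@[torus_vec predT t 0] = 0) ->
  toric_invariant phi -> \sum_(a <- msupp F) F@_a * phi a = 0.
Proof.
move=> hF F0 phiI; have supT a : supp_in predT a by apply/forallP.
have [//||E|] := @toric_sums F 1 predT phi (fun=> 1) hF homogeneous1 phiI _.
- by move=> t /F0 Ft; rewrite mulr1.
- by rewrite -[RHS]E; apply: eq_bigl => a; rewrite supT.
rewrite msupp1 big_mkcond big_seq1 supT mulr1 mcoeff1 eqxx => /eqP.
by rewrite oner_eq0.
Qed.

Lemma torus_point_neq0 (t : M -> k) u : torus_point setT t -> t u != 0.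
Proof.
move=> [t0 tD]; apply/eqP => tu; have := tD u (- u) I I.
by rewrite subrr t0 tu mul0r => /eqP; rewrite oner_eq0.
Qed.

Lemma torus_point_weight (H : set M) (t : M -> k) (u : 'I_m.+1 -> M) a :
  torus_point H t ->
  H 0 -> (forall x y : M, H x -> H y -> H (x + y)) -> (forall i, H (u i)) ->
  \prod_i t (u i) ^+ a i = t (\sum_i u i *+ a i).
Proof.
move=> [t0 tD] H0 HD Hu.
have Hn i e : H (u i *+ e) /\ t (u i) ^+ e = t (u i *+ e).
  elim: e => [|e [He IH]]; first by rewrite mulr0n expr0 t0.
  by rewrite exprS mulrS tD // IH; split=> //; apply: HD.
suff [] : H (\sum_i u i *+ a i) /\ \prod_i t (u i) ^+ a i = t (\sum_i u i *+ a i) by [].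
elim/big_rec2: _ => [|i x y _ [Hy ->]]; first by rewrite t0.
by have [Hi ->] := Hn i (a i); rewrite tD //; split=> //; apply: HD.
Qed.

Lemma torus_vec_invariant t : torus_point setT t -> toric_invariant (mon (torus_vec predT t)).
Proof.
move=> tt a b [_ ab]; rewrite /mon /torus_vec.
under eq_bigr do rewrite mxE /=; under [RHS]eq_bigr do rewrite mxE /=.
by rewrite !(torus_point_weight _ tt) //; congr (t _).
Qed.

Lemma monZ (x : k) v a : mon (x *: v) a = x ^+ mdeg a * mon v a.
Proof.
rewrite /mon mdegE -prodrXr -big_split; apply: eq_bigr => i _.
by rewrite mxE exprMn.
Qed.

Lemma toric_coneZ c v x : toric_cone c v -> toric_cone c (x *: v).
Proof.
move=> [vc vI]; split=> [i /vc|a b ab]; first by rewrite mxE => ->; rewrite mulr0.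
by rewrite !monZ (vI _ _ ab); case: ab => ->.
Qed.

Definition toric_set c : set (ppoint k m) :=
  [set x | forall v, hcoords x v -> toric_cone c v].

Lemma toric_setP c x v : hcoords x v -> toric_set c x <-> toric_cone c v.
Proof.
move=> xv; split=> [/(_ _ xv)//|vc w xw].
by have [a _ ->] := hcoords_uniq xv xw; apply: toric_coneZ.
Qed.

Lemma zclosed_toric_set c : zclosed (toric_set c).
Proof.
pose S := [set F : {mpoly k[m.+1]} | (exists2 i, ~~ c i & F = 'X_i) \/
  exists a b, toric_eqv a b /\ F = 'X_[a] - 'X_[b]].
have hS : S `<=` @homogeneous k m.
  move=> F [[i _ ->]|[a [b [[ab _] ->]]]]; first by exists 1%N; rewrite dhomogX /= mdeg1.
  by exists (mdeg a); rewrite rpredB // dhomogX //= ab.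
exists S => //; apply/seteqP; split=> x /=; have [v xv] := hcoords_ex x.
  move=> /(toric_setP _ xv)[vc vI] F SF; rewrite (vanishesE (hS _ SF) xv).
  case: SF => [[i ci ->]|[a [b [ab ->]]]]; first by rewrite mevalXU vc.
  by rewrite mevalB !mevalX; apply/eqP; rewrite subr_eq0; apply/eqP/vI.
move=> xS; apply/(toric_setP _ xv); split=> [i ci|a b ab].
  have SF : S 'X_i by left; exists i.
  by have := xS _ SF; rewrite (vanishesE (hS _ SF) xv) mevalXU.
have SF : S ('X_[a] - 'X_[b]) by right; exists a, b.
by have := xS _ SF; rewrite (vanishesE (hS _ SF) xv) mevalB !mevalX => /subr0_eq.
Qed.

Lemma toric_X_E : toric_X A = toric_set predT :> set (ppoint k m).
Proof.
apply/seteqP; split.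
  apply: zclosure_sub; first exact: zclosed_toric_set.
  move=> x [t tt xt]; apply/(toric_setP _ xt); split=> [//|].
  have -> : \row_i t (A i) = torus_vec predT t by apply/rowP => i; rewrite !mxE.
  exact: torus_vec_invariant.
move=> x xA _ [[S hS ->] SC] F SF.
have hF := hS _ SF; have [v xv] := hcoords_ex x.
rewrite (vanishesE hF xv).
have [t tt|F0|/(_ v)] := @toric_prime F 1 predT hF homogeneous1.
- have t0 : torus_vec predT t != 0.
    apply/eqP => /rowP/(_ ord0); rewrite !mxE /= => /eqP.
    by rewrite (negbTE (torus_point_neq0 _ tt)).
  rewrite mulr1 -(vanishesE hF (hcoords_ppt t0)); apply: SC => //.
  by exists t => //; rewrite /hcoords /=; congr (<[_]>)%VS; apply/rowP => i; rewrite !mxE.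
- exact/F0/xA.
by rewrite meval1 => /(_ (xA _ xv)) /eqP; rewrite oner_eq0.
Qed.

End Toric.

(** * Splitting of the relations into blocks *)

Section Blocks.
Variables (k : fieldType) (k0 : [pchar k] =i pred0).
Variables (M : zmodType) (M_free : free_of_finite_rank M).
Variables (m : nat) (A : 'I_m.+1 -> M).
Implicit Types (a b : 'X_{1..m.+1}) (v w x y z : 'rV[k]_m.+1) (c : pred 'I_m.+1).
Local Notation toric_eqv := (toric_eqv A).
Local Notation toric_invariant := (toric_invariant A).
Local Notation toric_cone := (toric_cone A).

Definition had z w : 'rV[k]_m.+1 := \row_i (z 0 i * w 0 i).

Lemma hadA x y z : had x (had y z) = had (had x y) z.
Proof. by apply/rowP => i; rewrite !mxE mulrA. Qed.

Lemma hadC x y : had x y = had y x.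
Proof. by apply/rowP => i; rewrite !mxE mulrC. Qed.

Definition wsum w a : k := \sum_i w 0 i *+ a i.

Lemma wsumZ (x : k) w a : wsum (x *: w) a = x * wsum w a.
Proof. by rewrite /wsum mulr_sumr; apply: eq_bigr => i _; rewrite mxE mulrnAr. Qed.

Lemma wsumD v w a : wsum (v + w) a = wsum v a + wsum w a.
Proof. by rewrite /wsum -big_split; apply: eq_bigr => i _; rewrite mxE mulrnDl. Qed.

(** The annihilator of the relations between the elements of [A], that is, the
    span of the rows of the matrix of the vectors [(1, A i)]. *)
Definition row_space w := toric_invariant (wsum w).

Lemma row_spaceZ (x : k) w : row_space w -> row_space (x *: w).
Proof. by move=> hw a b ab; rewrite !wsumZ (hw _ _ ab). Qed.

Lemma row_spaceD v w : row_space v -> row_space w -> row_space (v + w).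
Proof. by move=> hv hw a b ab; rewrite !wsumD (hv _ _ ab) (hw _ _ ab). Qed.

(** Diagonal matrices are identified with vectors, and their product with the
    entrywise product [had]. *)
Definition multiplier z := forall w, row_space w -> row_space (had z w).

Lemma multiplier_const (x : k) : multiplier (const_mx x).
Proof.
move=> w hw; have -> : had (const_mx x) w = x *: w by apply/rowP => i; rewrite !mxE.
exact: row_spaceZ.
Qed.

Lemma multiplierD y z : multiplier y -> multiplier z -> multiplier (y + z).
Proof.
move=> hy hz w hw; have -> : had (y + z) w = had y w + had z w.
  by apply/rowP => i; rewrite !mxE mulrDl.
by apply: row_spaceD; [exact: hy|exact: hz].
Qed.

Lemma multiplierM y z : multiplier y -> multiplier z -> multiplier (had y z).
Proof. by move=> hy hz w hw; rewrite -hadA; apply/hy/hz. Qed.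

Lemma multiplierZ (x : k) z : multiplier z -> multiplier (x *: z).
Proof.
move=> hz; have -> : x *: z = had (const_mx x) z by apply/rowP => i; rewrite !mxE.
by apply: multiplierM => //; apply: multiplier_const.
Qed.

Definition block i j : bool := `[< forall z, multiplier z -> z 0 i = z 0 j >].

Lemma blockP i j : reflect (forall z, multiplier z -> z 0 i = z 0 j) (block i j).
Proof. exact: asboolP. Qed.

Lemma block_eqE i j : block i j -> block i =1 block j.
Proof.
move=> /blockP ij l; apply/blockP/blockP => H z hz; rewrite -(H z hz) ?(ij z hz) //.
Qed.

(** A subalgebra of [k^I] consists of the functions that are constant on the
    classes of a partition of [I]: the indicators of the classes are obtained
    by interpolation. *)
Lemma multiplier_block i : multiplier (\row_j (block i j)%:R).
Proof.
suff [f [hf fi f0]] : exists f, [/\ multiplier f, f 0 i = 1 &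
    forall j, j \in enum 'I_m.+1 -> ~~ block i j -> f 0 j = 0].
  suff -> : \row_j (block i j)%:R = f by [].
  apply/rowP => j; rewrite mxE.
  by case: (boolP (block i j)) => [/blockP/(_ _ hf) <-|/f0 ->]; rewrite ?fi ?mem_enum.
elim: (enum 'I_m.+1) => [|j s [f [hf fi f0]]].
  by exists (const_mx 1); split; [exact: multiplier_const|rewrite mxE|].
case: (boolP (block i j)) => [bij|nij].
  exists f; split=> // l; rewrite inE => /orP[/eqP ->|]; first by rewrite bij.
  exact: f0.
have [z /not_implyP[hz zij]] : exists z, ~ (multiplier z -> z 0 i = z 0 j).
  by apply/existsNP => H; move/negP: nij; apply; apply/blockP.
have d0 : z 0 i - z 0 j != 0 by rewrite subr_eq0; apply/eqP.
exists (had ((z 0 i - z 0 j)^-1 *: (z + const_mx (- z 0 j))) f); split.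
- apply: multiplierM => //; apply/multiplierZ/multiplierD => //.
  exact: multiplier_const.
- by rewrite !mxE fi mulr1 mulVf.
move=> l; rewrite inE => /orP[/eqP ->|ls] nil; first by rewrite !mxE subrr mulr0 mul0r.
by rewrite mxE f0 // mulr0.
Qed.

Lemma natr_inj0 (p q : nat) : p%:R = q%:R :> k -> p = q.
Proof.
move=> E; wlog le_qp : p q E / (q <= p)%N.
  by move=> W; case: (leqP q p) => [|/ltnW] h; [exact: W|apply/esym/W].
apply/eqP; rewrite eqn_leq le_qp andbT -subn_eq0.
by rewrite -((pcharf0P k).1 k0) natrB // E subrr.
Qed.

Lemma intr_inj0 (p : int) : p%:~R = 0 :> k -> p = 0.
Proof.
case: (intP p) => [//|n|n] => /eqP; rewrite ?rmorphN /= ?oppr_eq0 => /eqP E.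
  by have := @natr_inj0 n.+1 0 E.
by have := @natr_inj0 n.+1 0 E.
Qed.

Definition mrestr c a : 'X_{1..m.+1} := [multinom (if c i then a i else 0%N) | i < m.+1].

(** The relations between the elements of [A] are the integral vectors
    orthogonal to the row space, because this space contains the values on [A]
    of all linear forms. *)
Lemma toric_eqv_restr c a b : multiplier (\row_i (c i)%:R) ->
  toric_eqv a b -> toric_eqv (mrestr c a) (mrestr c b).
Proof.
move=> hc ab.
have W w : row_space w -> wsum w (mrestr c a) = wsum w (mrestr c b).
  move=> hw; have E e : wsum w (mrestr c e) = wsum (had (\row_i (c i)%:R) w) e.
    apply: eq_bigr => i _; rewrite mnmE !mxE; case: (c i); rewrite ?mul1r ?mul0r //.
    by rewrite mul0rn.
  by rewrite !E; apply: hc.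
split.
  apply: natr_inj0; have /W : row_space (const_mx 1).
    have E e : wsum (const_mx 1) e = (mdeg e)%:R.
      by rewrite /wsum mdegE natr_sum; apply: eq_bigr => i _; rewrite mxE.
    by move=> e f [ef _]; rewrite !E ef.
  rewrite /wsum !mdegE !natr_sum => E; under eq_bigr => i _.
    have -> : (mrestr c a i)%:R = const_mx 1 (0 : 'I_1) i *+ mrestr c a i :> k by rewrite mxE.
    over.
  by rewrite E; apply: eq_bigr => i _; rewrite mxE.
have [lam lam0] := separating_form [:: weight A (mrestr c a) - weight A (mrestr c b)] M_free.
apply/subr0_eq/lam0; rewrite ?inE // raddfB /=; apply: intr_inj0.
pose w : 'rV[k]_m.+1 := \row_i (lam (A i))%:~R.
have E e : wsum w e = (lam (weight A e))%:~R.
  rewrite /wsum /weight !raddf_sum; apply: eq_bigr => i _.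
  by rewrite mxE !raddfMn.
have /W : row_space w by move=> e f [_ ef]; rewrite !E ef.
by rewrite !E raddfB /= => ->; rewrite subrr.
Qed.

(** The fibers of [kap] are the connected components of the matroid of the
    vectors [(1, A i)]. *)
Lemma splitting : exists d (kap : 'I_m.+1 -> 'I_d.+1), [/\
  forall c : 'I_d.+1, exists i, kap i = c,
  forall (c : 'I_d.+1) a b, toric_eqv a b ->
    toric_eqv (mrestr [pred i | kap i == c] a) (mrestr [pred i | kap i == c] b) &
  forall z, multiplier z <-> exists u : 'rV[k]_d.+1, forall i, z 0 i = u 0 (kap i)].
Proof.
pose f i := [set j | block i j]%SET.
have fE i j : (f i == f j) = block i j.
  apply/eqP/idP => [/setP/(_ j)|/block_eqE E]; last by apply/setP => l; rewrite !inE E.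
  by rewrite !inE => ->; apply/blockP.
have [d [s [us sz fs sf]]] : exists d (s : seq {set 'I_m.+1}), [/\ uniq s,
    size s = d.+1, forall i, f i \in s & forall e, e \in s -> exists i, f i = e].
  have fs i : f i \in undup (codom f) by rewrite mem_undup codom_f.
  exists (size (undup (codom f))).-1, (undup (codom f)); split=> //.
  - exact: undup_uniq.
  - by case: (undup _) (fs ord0).
  - by move=> e; rewrite mem_undup => /codomP[i ->]; exists i.
have lts i : (index (f i) s < d.+1)%N by rewrite -sz index_mem.
pose kap i : 'I_d.+1 := Ordinal (lts i).
have kapE i j : (kap i == kap j) = block i j.
  rewrite -fE -val_eqE /=; apply/eqP/eqP => [E|-> //].
  by rewrite -(nth_index (f i) (fs i)) E (nth_index _ (fs j)).
have kap_surj (c : 'I_d.+1) : exists i, kap i = c.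
  have [|i fi] := sf (nth (f ord0) s c); first by rewrite mem_nth // sz.
  by exists i; apply: val_inj; rewrite /= fi index_uniq // sz.
have hc (c : 'I_d.+1) : multiplier (\row_i (kap i == c)%:R).
  have [i <-] := kap_surj c.
  have -> : \row_j (kap j == kap i)%:R = \row_j (block i j)%:R :> 'rV[k]_m.+1.
    by apply/rowP => j; rewrite !mxE eq_sym kapE.
  exact: multiplier_block.
exists d, kap; split=> // [c a b|z].
  by apply: toric_eqv_restr; apply: hc.
split=> [hz|[u zE]].
  have [g gE] := choice kap_surj; exists (\row_c z 0 (g c)) => i; rewrite mxE.
  by have /blockP/(_ _ hz) : block (g (kap i)) i by rewrite -kapE gE.
have -> : z = \sum_c u 0 c *: \row_i (kap i == c)%:R.
  apply/rowP => i; rewrite summxE (bigD1 (kap i)) //= !mxE eqxx mulr1 big1 ?addr0 //.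
  by move=> c ci; rewrite !mxE eq_sym (negbTE ci) mulr0.
elim/big_ind: _ => [||c _]; last exact: multiplierZ.
- have -> : 0 = const_mx 0 :> 'rV[k]_m.+1 by apply/rowP => i; rewrite !mxE.
  exact: multiplier_const.
- exact: multiplierD.
Qed.

End Blocks.

Section Glue.
Variables (k : fieldType) (M : zmodType) (m : nat) (A : 'I_m.+1 -> M).
Variables (d : nat) (kap : 'I_m.+1 -> 'I_d.+1).
Implicit Types (a b : 'X_{1..m.+1}) (v w : 'rV[k]_m.+1).
Local Notation toric_cone := (toric_cone A).
Local Notation blk c := [pred i | kap i == c].
Hypothesis split : forall (c : 'I_d.+1) a b,
  toric_eqv A a b -> toric_eqv A (mrestr (blk c) a) (mrestr (blk c) b).

Definition vrestr (c : pred 'I_m.+1) v : 'rV[k]_m.+1 :=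
  \row_i (if c i then v 0 i else 0).

Lemma mon_blocks v a : mon v a = \prod_c mon (vrestr (blk c) v) (mrestr (blk c) a).
Proof.
rewrite /mon (partition_big kap predT) //=; apply: eq_bigr => c _.
rewrite [LHS]big_mkcond; apply: eq_bigr => i _; rewrite mnmE !mxE /=.
by case: eqP.
Qed.

(** Since relations split along the blocks, [X_A] is the join of the pieces
    that are supported on the blocks. *)
Lemma toric_cone_glue v :
  (forall c, toric_cone (blk c) (vrestr (blk c) v)) -> toric_cone predT v.
Proof.
move=> H; split=> // a b ab; rewrite !mon_blocks; apply: eq_bigr => c _.
by have [_] := H c; apply; apply: split.
Qed.

Lemma toric_cone_restr v c : toric_cone predT v -> toric_cone (blk c) (vrestr (blk c) v).
Proof.
move=> [_ vI]; split=> [i /negbTE ci|a b ab]; first by rewrite mxE ci.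
have E e : mon (vrestr (blk c) v) e = if supp_in (blk c) e then mon v e else 0.
  by rewrite /mon -mon_torus; apply: eq_bigr => i _; rewrite mxE.
(* The support condition depends only on the class of the exponent, because
   the degree of its restriction to each block does. *)
have S e : supp_in (blk c) e = [forall c', (c' != c) ==> (mdeg (mrestr (blk c') e) == 0)%N].
  apply/forallP/forallP => H.
    move=> c'; apply/implyP => cc'; rewrite mdegE; apply/eqP/big1 => i _; rewrite mnmE /=.
    by case: eqP => // ic'; have := H i; rewrite /= ic' (negbTE cc') => /eqP.
  move=> i; rewrite /=; have [//|ic] := eqVneq (kap i) c; rewrite orFb.
  have := H (kap i); rewrite ic mdegE sum_nat_eq0 => /forallP/(_ i).
  by rewrite mnmE /= eqxx.
rewrite !E (_ : supp_in (blk c) a = supp_in (blk c) b); first by rewrite (vI _ _ ab).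
rewrite !S; apply: eq_forallb => c'.
by have [-> _] := split c' ab.
Qed.

Definition block_scale (u : 'rV[k]_d.+1) v := had (\row_i u 0 (kap i)) v.

Lemma toric_cone_scale u v : toric_cone predT v -> toric_cone predT (block_scale u v).
Proof.
move=> hv; apply: toric_cone_glue => c.
have -> : vrestr (blk c) (block_scale u v) = u 0 c *: vrestr (blk c) v.
  by apply/rowP => i; rewrite !mxE /=; case: eqP => [->|]; rewrite ?mulr0.
exact/toric_coneZ/toric_cone_restr.
Qed.

End Glue.

(** * Tangent spaces of a toric variety *)

Section Tangent.
Variables (k : fieldType) (k0 : [pchar k] =i pred0).
Variables (M : zmodType) (M_free : free_of_finite_rank M).
Variables (m : nat) (A : 'I_m.+1 -> M).
Variables (N : nat) (g : 'Hom('rV[k]_m.+1, 'rV[k]_N.+1)) (g_inj : lker g == 0%VS).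
Implicit Types (x y z w : 'rV[k]_m.+1).
Local Notation X := (pimage g (toric_X A)).

Lemma pimage_toricP q : X q <-> exists2 v, hcoords q (g v) & toric_cone A predT v.
Proof.
rewrite (toric_X_E k0 M_free); split=> [/pimageP[x [v [xA xv qv]]]|[v qv hv]].
  by exists v => //; apply: xA.
have v0 : v != 0.
  by apply: contraNneq (hcoords_neq0 qv) => ->; rewrite linear0.
apply/pimageP; exists (ppt v0), v; split=> //.
by apply/(toric_setP _ _ (hcoords_ppt v0)).
Qed.

Lemma torus_neq0 t : torus_point setT t -> torus_vec A predT t != 0 :> 'rV[k]_m.+1.
Proof.
move=> tt; apply/eqP => /rowP/(_ ord0); rewrite !mxE /= => /eqP.
by rewrite (negbTE (torus_point_neq0 _ tt)).
Qed.

Lemma torus_cone t : torus_point setT t ->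
  toric_cone A predT (torus_vec A predT t : 'rV[k]_m.+1).
Proof. by move=> tt; split=> //; apply: torus_vec_invariant. Qed.

(** The equations of the embedded tangent space of [X] at the point with
    homogeneous coordinates [y]. *)
Definition tangent_eqs (y v : 'rV[k]_N.+1) : Prop :=
  forall F, homogeneous F -> (forall p, X p -> vanishes_at F p) -> dirder F y v = 0.

Lemma vanish_pullback F : homogeneous F -> (forall p, X p -> vanishes_at F p) ->
  forall v, toric_cone A predT v -> v != 0 -> (pullback g F).@[v 0] = 0.
Proof.
move=> hF FX v hv v0; have gv0 := inj_neq0 g_inj v0.
rewrite pullbackE -(vanishesE hF (hcoords_ppt gv0)); apply: FX.
by apply/pimage_toricP; exists v.
Qed.

(** The torus acts on [X], so its Lie algebra is tangent to [X]. *)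
Lemma tangent_orbit y w : toric_cone A predT y -> row_space A w ->
  tangent_eqs (g y) (g (had y w)).
Proof.
move=> [_ yI] hw F hF FX; rewrite -dirder_pullback dirder_orbit.
apply: (toric_vanish k0 M_free (A := A)) => [|t tt|a b ab].
- exact: homogeneous_pullback.
- by have := vanish_pullback hF FX (torus_cone tt) (torus_neq0 tt).
congr (_ * _); [exact: yI|exact: hw].
Qed.

(** The equations of the image of [g] and the differentials at [y] of the
    binomials suffice to show that a tangent vector is in the orbit direction;
    a monomial has logarithmic differential [sum a_i w_i] along [y w]. *)
Lemma tangent_torus y v : toric_cone A predT y -> (forall i, y 0 i != 0) ->
  tangent_eqs (g y) v -> exists2 w, row_space A w & v = g (had y w).
Proof.
move=> [yc yI] y0 hv.
have vg : v \in limg g.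
  apply/equationsP/rowP => i; rewrite mxE -(dirder_lin_form _ i (g y) v).
  apply: hv; first by exists 1%N; apply: lin_form_homog.
  move=> p /pimage_toricP[u pu _]; rewrite (vanishesE _ pu); last first.
    by exists 1%N; apply: lin_form_homog.
  rewrite lin_formE; have /equationsP -> : g u \in limg g by rewrite memv_img ?memvf.
  by rewrite mxE.
have [u _ vE] := memv_imgP vg; pose w := (\row_i ((y 0 i)^-1 * u 0 i)) : 'rV[k]_m.+1.
have uE : u = had y w by apply/rowP => i; rewrite !mxE mulVKf.
exists w; last by rewrite vE uE.
move=> a b ab; pose B : {mpoly k[m.+1]} := 'X_[a] - 'X_[b].
have hB : homogeneous B.
  by exists (mdeg a); rewrite rpredB // dhomogX //=; case: ab => ->.
have := hv (pullback g^-1%VF B) (homogeneous_pullback _ hB).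
rewrite dirder_pullback vE !retractK // uE dirderD dirderN !dirder_monomial.
have ya : mon y a != 0 by apply/prodf_neq0 => i _; rewrite expf_neq0.
rewrite -/(mon y a) -/(mon y b) -(yI _ _ ab) -mulrBr => E.
apply/eqP; rewrite -subr_eq0; apply/eqP/(mulfI ya); rewrite mulr0 -[RHS]E //.
move=> p /pimage_toricP[x px [_ xI]].
rewrite (vanishesE (homogeneous_pullback _ hB) px) pullbackE retractK //.
by rewrite mevalB !mevalX; apply/eqP; rewrite subr_eq0; apply/eqP/xI.
Qed.

(** The partial derivatives of a form are forms, so the equations of the tangent
    space do not depend on the choice of homogeneous coordinates. *)
Lemma dirderZl n (F : {mpoly k[n]}) d (x : k) (w v : 'rV[k]_n) : F \is d.-homog ->
  x != 0 -> dirder F w v = 0 -> dirder F (x *: w) v = 0.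
Proof.
move=> hF x0 E; have hdF i : F^`M(i) \is d.-1.-homog.
  apply/dhomogP => a; rewrite mcoeff_msupp mcoeff_mderiv => /eqP Fa.
  have : (a + U_(i))%MM \in msupp F.
    by rewrite mcoeff_msupp; apply/eqP => Fa0; apply: Fa; rewrite Fa0 mul0rn.
  move=> /(dhomogP _ _ _ hF) /= <-.
  by transitivity (mdeg (a + U_(i))%MM).-1; rewrite // mdegD mdeg1 addn1.
rewrite /dirder; under eq_bigr do rewrite (homog_scale _ _ (hdF _)) -mulrA.
by rewrite -mulr_sumr -/(dirder F w v) E mulr0.
Qed.

Lemma tangent_spaceP q (y : 'rV[k]_N.+1) T : hcoords q y ->
  embedded_tangent_space X q T <-> (forall v, v \in T <-> tangent_eqs y v).
Proof.
move=> qy; have E v : tangent_eqs y v <->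
    (forall F, homogeneous F -> (forall p, X p -> vanishes_at F p) ->
     forall w : 'rV[k]_N.+1, hcoords q w -> \sum_(i < N.+1) (mderiv i F).@[w 0] * v 0 i = 0).
  split=> [H F hF FX w qw|H F hF FX]; last exact: H.
  have [x x0 ->] := hcoords_uniq qy qw; have [d Fd] := hF.
  by apply: (dirderZl Fd x0); apply: H.
by split=> H v; [exact: (iff_trans (H v) (iff_sym (E v)))|exact: (iff_trans (H v) (E v))].
Qed.

End Tangent.

(** * Krull dimension of sets that are almost linear *)

Lemma linear_dependence (k : fieldType) (V : vectType k) p (f : 'I_p -> V) :
  (\dim {:V} < p)%N ->
  exists c : 'I_p -> k, (exists i, c i != 0) /\ \sum_i c i *: f i = 0.
Proof.
move=> ltp; apply: contrapT => nc; move: ltp; apply/negP; rewrite -leqNgt.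
have : free [tuple f i | i < p].
  apply/freeP => c c0 i; apply/eqP/negPn/negP => ci; apply: nc; exists c.
  split; first by exists i.
  by rewrite -[RHS]c0; apply: eq_bigr => j _; rewrite -tnth_nth tnth_mktuple.
move=> /eqP dE; have := dimvS (subvf <<[tuple f i | i < p]>>%VS).
by rewrite dE size_tuple.
Qed.

Lemma bin_leq_exp e d : ('C(e + d, d) <= e.+1 ^ d)%N.
Proof.
elim: d => [|d IH]; first by rewrite bin0.
rewrite -(leq_pmul2l (ltn0Sn d)) addnS -mul_bin_diag expnS mulnA.
apply: leq_mul => //; lia.
Qed.

Lemma dim_forms (k : fieldType) d e : \dim {:dhomog d.+1 k e} = 'C(e + d, e).
Proof. by rewrite dimvf. Qed.

Section CommonNonzero.
Variables (k : fieldType) (k0 : [pchar k] =i pred0).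

(** On the line through [u] and [v], both polynomials are nonzero polynomials in
    one parameter. *)
Lemma common_nonzero n (F G : {mpoly k[n]}) (u v : 'rV[k]_n) :
  F.@[u 0] != 0 -> G.@[v 0] != 0 -> exists w : 'rV[k]_n, F.@[w 0] != 0 /\ G.@[w 0] != 0.
Proof.
move=> Fu Gv; pose f (H : {mpoly k[n]}) : {poly k} :=
  mmap (@polyC k) (fun i => (u 0 i)%:P + (v 0 i - u 0 i) *: 'X) H.
have fE H x : (f H).[x] = H.@[(u + x *: (v - u)) 0].
  rewrite /f /mmap mevalE horner_sum; apply: eq_bigr => a _.
  rewrite hornerM hornerC horner_prod; congr (_ * _); apply: eq_bigr => i _.
  by rewrite horner_exp hornerD hornerZ hornerC hornerX !mxE mulrC.
have fF0 : f F != 0.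
  by apply: contraNneq Fu => fF; rewrite -[u]addr0 -(scale0r (v - u)) -fE fF horner0.
have fG0 : f G != 0.
  apply: contraNneq Gv => fG; have <- : u + 1 *: (v - u) = v by rewrite scale1r addrC subrK.
  by rewrite -fE fG horner0.
have [r [_]] := poly_nonroot k0 (mulf_neq0 fF0 fG0).
rewrite hornerM mulf_eq0 negb_or !fE => /andP[Fw Gw].
by exists (u + r.+1%:R *: (v - u)).
Qed.

End CommonNonzero.

Section LowerBound.
Variables (k : fieldType) (k0 : [pchar k] =i pred0).
Variables (N d : nat) (b : 'Hom('rV[k]_d.+1, 'rV[k]_N.+1)) (b_inj : lker b == 0%VS).
Variable S : set (ppoint k N).
Hypothesis S_torus : forall (u : 'rV[k]_d.+1) p,
  (forall c, u 0 c != 0) -> hcoords p (b u) -> S p.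

Definition flag_index j (c : 'I_d.+1) : 'I_d.+1 := if (c < j)%N then c else ord_max.

(** The projection onto the subspace of the rows whose entries from index [j]
    on are all equal. *)
Definition flag_proj j : 'Hom('rV[k]_d.+1, 'rV[k]_d.+1) :=
  linfun (mulmxr (\matrix_(e, c) (e == flag_index j c)%:R)).

Lemma flag_projE j (u : 'rV[k]_d.+1) c : flag_proj j u 0 c = u 0 (flag_index j c).
Proof.
rewrite lfunE /= mxE (bigD1 (flag_index j c)) //= mxE eqxx mulr1.
by rewrite big1 ?addr0 // => e ec; rewrite mxE (negbTE ec) mulr0.
Qed.

Definition flag j : set (ppoint k N) :=
  S `&` [set p | (pline p <= limg (b \o flag_proj j))%VS].

Lemma flagP j p : flag j p <-> S p /\ exists u, hcoords p (b (flag_proj j u)).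
Proof.
split=> [[Sp /= ple]|[Sp [u pu]]]; split=> //.
  have [v pv] := hcoords_ex p; move: ple; rewrite pv -memvE => /memv_imgP[u _ vE].
  by exists u; rewrite -comp_lfunE -vE.
by rewrite /= pu -memvE -comp_lfunE memv_img ?memvf.
Qed.

Lemma flag_proj_const j : flag_proj j (const_mx 1) = const_mx 1.
Proof. by apply/rowP => c; rewrite flag_projE !mxE. Qed.

Lemma const1_neq0 : b (const_mx 1) != 0.
Proof.
apply: (inj_neq0 b_inj); apply/eqP => /rowP/(_ ord0); rewrite !mxE => /eqP.
by rewrite oner_eq0.
Qed.

(** The set [flag j] contains all points of a linear subspace with no zero
    coordinate; two forms that are not zero on this subspace and the product of
    the coordinates have a common non-zero. *)
Lemma flag_irreducible j : zirreducible (flag j).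
Proof.
have S1 (u : 'rV[k]_d.+1) : b u != 0 -> (forall c, u 0 c != 0) ->
    exists2 p, S p & hcoords p (b u).
  by move=> bu0 u0; exists (ppt bu0); [apply: (S_torus u0)|]; apply: hcoords_ppt.
apply/zirreducibleP; split.
  have [|p Sp pu] := S1 _ const1_neq0; first by move=> c; rewrite mxE oner_eq0.
  exists p; apply/flagP; split=> //; exists (const_mx 1).
  by rewrite flag_proj_const.
move=> F G hF hG FG; apply: contrapT => /not_orP[].
move=> /existsNP[p /not_implyP[/flagP[_ [u pu]] /(vanishesE hF pu) /eqP Fp]].
move=> /existsNP[q /not_implyP[/flagP[_ [v qv]] /(vanishesE hG qv) /eqP Gq]].
pose pb := pullback (b \o flag_proj j)%VF.
have pbE H (w : 'rV[k]_d.+1) : (pb H).@[w 0] = H.@[b (flag_proj j w) 0].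
  by rewrite pullbackE comp_lfunE.
rewrite -!pbE in Fp Gq.
have [w [Fw Gw]] := common_nonzero k0 Fp Gq.
pose H : {mpoly k[d.+1]} := pullback (flag_proj j) (\prod_c 'X_c).
have HE (x : 'rV[k]_d.+1) : H.@[x 0] = \prod_c flag_proj j x 0 c.
  by rewrite pullbackE rmorph_prod; apply: eq_bigr => c _; apply: mevalXU.
have FGw : (pb F * pb G).@[w 0] != 0 by rewrite mevalM mulf_neq0.
have H1 : H.@[(const_mx 1 : 'rV_d.+1) 0] != 0.
  by rewrite HE flag_proj_const; apply/prodf_neq0 => c _; rewrite mxE oner_eq0.
have [x [FGx Hx]] := common_nonzero k0 FGw H1.
have x0 c : flag_proj j x 0 c != 0.
  by move: Hx; rewrite HE => /prodf_neq0; apply.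
have bx0 : b (flag_proj j x) != 0.
  apply: (inj_neq0 b_inj); apply/eqP => /rowP/(_ ord0) E.
  by have := x0 ord0; rewrite E mxE eqxx.
have [r Sr rx] := S1 _ bx0 x0.
move/eqP: FGx; apply; rewrite mevalM !pbE -mevalM.
rewrite -(vanishesE (homogeneousM hF hG) rx); apply: FG; apply/flagP; split=> //.
by exists x.
Qed.

Lemma flag_chain : exists Z, irreducible_chain S d Z.
Proof.
exists flag; split=> [j _|j jd].
  split; last exact: flag_irreducible.
  by eexists; last reflexivity; apply: zclosed_linear.
split=> [p /flagP[Sp [u pu]]|].
  apply/flagP; split=> //; exists (flag_proj j u).
  rewrite (_ : flag_proj j.+1 _ = flag_proj j u) //; apply/rowP => c.
  rewrite !flag_projE; congr (u 0 _).
  rewrite {2}/flag_index; case: (ltnP c j.+1) => // jc.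
  by rewrite /flag_index /= !ltnNge (ltnW jd) (ltnW jc).
(* A vector fixed by [flag_proj j.+1] but not by [flag_proj j]. *)
pose u : 'rV[k]_d.+1 := \row_c (if c == j :> nat then 2%:R else 1).
have k1 n : n.+1%:R != 0 :> k by rewrite ((pcharf0P k).1 k0).
have u0 c : u 0 c != 0 by rewrite mxE; case: ifP => _; rewrite ?k1 ?oner_eq0.
have bu0 : b u != 0.
  by apply: (inj_neq0 b_inj); apply: contraNneq (u0 ord0) => ->; rewrite mxE.
have uj1 : flag_proj j.+1 u = u.
  apply/rowP => c; rewrite flag_projE !mxE /flag_index ltnS.
  by case: leqP => //= jc; rewrite (gtn_eqF jc) (gtn_eqF jd).
move=> /(_ (ppt bu0)) [].
  apply/flagP; split; first exact: (S_torus u0 (hcoords_ppt bu0)).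
  by exists u; rewrite uj1.
move=> _; rewrite /= -memvE => /memv_imgP[v _]; rewrite comp_lfunE => /(lker0P b_inj) uE.
have := flag_projE j v (Ordinal (ltnW (jd : (j.+1 < d.+1)%N))).
have := flag_projE j v ord_max.
rewrite -!uE /flag_index /= !ltnn ltnNge (ltnW jd) /= => <-.
rewrite !mxE eqxx /= (gtn_eqF jd) => E;
have /addrI/eqP : 1 + 1 = 1 + 0 :> k by rewrite addr0 -[RHS]E.
by rewrite oner_eq0.
Qed.

End LowerBound.

Section UpperBound.
Variables (k : fieldType) (N : nat).
Implicit Types (F G H : {mpoly k[N.+1]}).

(** The monomials in [H 0], ..., [H j]: the exponents of [H 1], ..., [H j] are
    the digits of [code] in base [s], and the exponent of [H 0] makes the total
    degree equal to [e]. *)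
Fixpoint coded_mon (H : nat -> {mpoly k[N.+1]}) s j code e : {mpoly k[N.+1]} :=
  if j is j'.+1 then
    H j ^+ (code %/ s ^ j')%N * coded_mon H s j' (code %% s ^ j')%N (e - code %/ s ^ j')%N
  else H 0%N ^+ e.

Variables (H : nat -> {mpoly k[N.+1]}) (D s : nat).
Hypothesis H_homog : forall i, H i \is D.-homog.
Hypothesis s_gt0 : (0 < s)%N.

Lemma sum_digits j (f : nat -> {mpoly k[N.+1]}) :
  \sum_(code < s ^ j.+1) f code = \sum_(q < s) \sum_(r < s ^ j) f (q * s ^ j + r)%N.
Proof.
rewrite expnS -(big_mkord xpredT f); move: (s ^ j)%N => n.
elim: (s) => [|t IH]; first by rewrite mul0n big_geq // big_ord0.
rewrite big_ord_recr -IH mulSn addnC (@big_cat_nat _ _ _ (t * n)%N) ?leq_addr //=.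
congr (_ + _); rewrite -{1}(add0n (t * n)%N) big_addn addKn big_mkord.
by apply: eq_bigr => r _; rewrite addnC.
Qed.

Lemma coded_mon_homog j code e : (code < s ^ j)%N -> (j * s <= e)%N ->
  coded_mon H s j code e \is (D * e).-homog.
Proof.
elim: j code e => [|j IH] code e; first by move=> _ _; apply: dhomogMn.
move=> lt_c le_e /=; have qs : (code %/ s ^ j < s)%N.
  by rewrite ltn_divLR ?expn_gt0 ?s_gt0 // -expnS.
have -> : (D * e = D * (code %/ s ^ j) + D * (e - code %/ s ^ j))%N.
  rewrite -mulnDr subnKC //; apply: leq_trans le_e; rewrite mulSn.
  by apply: leq_trans (leq_addr _ _); apply: ltnW.
apply: dhomogM; first exact: dhomogMn.
apply: IH; first by rewrite ltn_mod expn_gt0 s_gt0.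
rewrite mulSn in le_e; lia.
Qed.

Variables (Z : nat -> set (ppoint k N)) (m : nat).
Hypothesis Z_irr : forall i, (i <= m)%N -> zirreducible (Z i).
Hypothesis Z_sub : forall i, (i < m)%N -> Z i `<=` Z i.+1.
Hypothesis H_van : forall i, (i < m)%N -> forall x, Z i x -> vanishes_at (H i.+1) x.
Hypothesis H_nvan : forall i, (i <= m)%N -> exists2 x, Z i x & ~ vanishes_at (H i) x.

Let homH i : homogeneous (H i). Proof. by exists D. Qed.

(** Modulo the ideal of the largest set of the chain, the last form is not a
    zero divisor; it vanishes on the previous set. Hence a relation between
    powers of this form, with coefficients that are linear combinations of
    monomials in the others, yields a relation between the latter on the
    previous set. *)
Lemma coded_mon_free j e (c : nat -> k) : (j <= m)%N -> (j * s <= e)%N ->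
  (forall x, Z j x -> vanishes_at (\sum_(code < s ^ j) c code *: coded_mon H s j code e) x) ->
  forall code, (code < s ^ j)%N -> c code = 0.
Proof.
elim: j e c => [|j IH] e c jm le_e van.
  case=> // _; have [x Zx Hx] := H_nvan jm.
  have := van _ Zx; rewrite expn0 big_ord1 /=; have [v xv] := hcoords_ex x.
  have hom : homogeneous (c 0%N *: H 0%N ^+ e).
    by exists (D * e)%N; rewrite rpredZ // dhomogMn.
  rewrite (vanishesE hom xv) mevalZ rmorphXn => /eqP; rewrite mulf_eq0 expf_eq0.
  move=> /orP[/eqP //|/andP[_ /eqP Hv]]; case: Hx.
  exact/(vanishesE (homH _) xv).
pose G q := \sum_(r < s ^ j) c (q * s ^ j + r)%N *: coded_mon H s j r (e - q).
have homG q : (q < s)%N -> G q \is (D * (e - q)).-homog.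
  move=> qs; apply: rpred_sum => r _; rewrite rpredZ // coded_mon_homog //.
  rewrite mulSn in le_e; lia.
have {}van x : Z j.+1 x -> vanishes_at (\sum_(q < s) H j.+1 ^+ q * G q) x.
  move=> /van; rewrite (sum_digits _ (fun code => c code *: coded_mon H s j.+1 code e)).
  congr (vanishes_at _ x); apply: eq_bigr => q _.
  rewrite /G mulr_sumr; apply: eq_bigr => r _ /=.
  rewrite divnMDl ?expn_gt0 ?s_gt0 // divn_small // addn0 modnMDl modn_small //.
  by rewrite scalerAr.
suff c0 q : (q < s)%N -> forall r, (r < s ^ j)%N -> c (q * s ^ j + r)%N = 0.
  move=> code lt_c; rewrite (divn_eq code (s ^ j)); apply: c0.
    by rewrite ltn_divLR ?expn_gt0 ?s_gt0 // -expnS.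
  by rewrite ltn_mod expn_gt0 s_gt0.
elim/ltn_ind: q => q IHq qs.
apply: (IH (e - q)%N (fun r => c (q * s ^ j + r)%N)); [exact: ltnW| |].
  rewrite mulSn in le_e; lia.
move=> x Zx; rewrite -/(G q).
pose Q := \sum_(p < s | (q <= p)%N) H j.+1 ^+ (p - q) * G p.
have homQ : Q \is (D * (e - q)).-homog.
  apply: rpred_sum => p qp; have ps := ltn_ord p.
  have -> : (D * (e - q) = D * (p - q) + D * (e - p))%N.
    by rewrite -mulnDr; congr (_ * _)%N; rewrite mulSn in le_e; lia.
  by apply: dhomogM; [exact: dhomogMn|exact: homG].
have hQ : homogeneous Q by eexists; apply: homQ.
have hHq : homogeneous (H j.+1 ^+ q) by exists (D * q)%N; apply: dhomogMn.
have [|hv|hv] := ((zirreducibleP _).1 (Z_irr jm)).2 (H j.+1 ^+ q) Q hHq hQ.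
- move=> y /van; congr (vanishes_at _ y); rewrite mulr_sumr [RHS]big_mkcond.
  apply: eq_bigr => p _; case: leqP => [qp|pq]; first by rewrite mulrA -exprD subnKC.
  rewrite /G big1 ?mulr0 // => r _; rewrite IHq ?scale0r //; exact: ltn_trans pq qs.
- have [y Zy Hy] := H_nvan jm; case: Hy; have [v yv] := hcoords_ex y.
  have := hv _ Zy; rewrite (vanishesE hHq yv) (vanishesE (homH _) yv) rmorphXn => /eqP.
  by rewrite expf_eq0 => /andP[_ /eqP].
have hGq : homogeneous (G q) by eexists; apply: homG.
have [v xv] := hcoords_ex x.
have := hv _ (Z_sub jm Zx); rewrite (vanishesE hQ xv) (vanishesE hGq xv).
have := H_van jm Zx; rewrite (vanishesE (homH _) xv) => Hv.
rewrite /Q (bigD1 (Ordinal qs)) //= subnn expr0 mul1r mevalD [X in _ + X]raddf_sum big1 ?addr0 //=.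
move=> p /andP[qp pq]; rewrite mevalM rmorphXn /= Hv expr0n subn_eq0.
have -> : (p <= q)%N = false; last by rewrite mul0r.
by apply/negbTE; rewrite -ltnNge ltn_neqAle qp andbT eq_sym.
Qed.

End UpperBound.

Section Dimension.
Variables (k : fieldType) (k0 : [pchar k] =i pred0).
Variables (N d : nat) (b : 'Hom('rV[k]_d.+1, 'rV[k]_N.+1)).
Variable S : set (ppoint k N).
Hypothesis S_sub : forall p, S p -> (pline p <= limg b)%VS.

(** On the image of [b] these forms are forms in [d + 1] variables, which are a
    space of dimension ['C(E + d, E)]. *)
Lemma forms_dependent n E (f : nat -> {mpoly k[N.+1]}) :
  (E.+1 ^ d < n)%N -> (forall i, (i < n)%N -> f i \is E.-homog) ->
  exists c : nat -> k, (exists2 i, (i < n)%N & c i != 0) /\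
    forall x, S x -> vanishes_at (\sum_(i < n) c i *: f i) x.
Proof.
move=> ltn hf; pose g (i : 'I_n) : dhomog d.+1 k E :=
  DHomog (pullback_homog b (hf i (ltn_ord i))).
have [|c [[i ci] c0]] := @linear_dependence _ _ n g.
  apply: leq_ltn_trans ltn; rewrite dim_forms -bin_sub ?leq_addr // addKn.
  exact: bin_leq_exp.
exists (fun j => if insub j is Some j' then c j' else 0); split.
  by exists i => //; rewrite valK.
move=> x /S_sub; have [v xv] := hcoords_ex x; rewrite xv -memvE => /memv_imgP[u _ vE].
rewrite (vanishesE _ xv); last first.
  by exists E; apply: rpred_sum => j _; rewrite rpredZ // hf.
have /(congr1 (fun p : dhomog d.+1 k E => (val p).@[u 0])) := c0.
rewrite /= !raddf_sum /= meval0 => E0; rewrite -[RHS]E0; apply: eq_bigr => j _ /=.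
by rewrite valK !mevalZ pullbackE vE.
Qed.

(** The first form does not vanish on the smallest set; the others separate two
    consecutive sets. They have positive degrees and a common degree is obtained
    by taking powers. *)
Lemma chain_forms m Z : irreducible_chain S m Z ->
  exists (H : nat -> {mpoly k[N.+1]}) (D : nat), [/\ forall i, H i \is D.-homog,
    forall i, (i < m)%N -> forall x, Z i x -> vanishes_at (H i.+1) x &
    forall i, (i <= m)%N -> exists2 x, Z i x & ~ vanishes_at (H i) x].
Proof.
move=> [Zc Zlt].
have Fex (i : 'I_m.+1) : exists FD : {mpoly k[N.+1]} * nat, [/\ (0 < FD.2)%N,
    FD.1 \is FD.2.-homog,
    forall i', i = i'.+1 :> nat -> forall x, Z i' x -> vanishes_at FD.1 x &
    exists2 x, Z i x & ~ vanishes_at FD.1 x].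
  have [_ [[x Zx] _]] := Zc i (ltn_ord i).
  case: i Zx => -[|i] im /= Zx.
    have [v xv] := hcoords_ex x; have [l vl] : exists l, v 0 l != 0.
      apply: contrapT => /forallNP vl; have /eqP := hcoords_neq0 xv; apply.
      by apply/rowP => l; rewrite mxE; apply/eqP/negPn/negP.
    exists ('X_l, 1%N); split=> //; first by rewrite dhomogX /= mdeg1.
    exists x => //; rewrite (vanishesE _ xv) ?mevalXU; first exact/eqP.
    by exists 1%N; rewrite dhomogX /= mdeg1.
  have [[C cC ZE] [[y Zy] _]] := Zc i (ltnW im).
  have [F [D hF] [CF [z Zz Fz]]] : exists2 F : {mpoly k[N.+1]}, homogeneous F &
      (forall x, C x -> vanishes_at F x) /\ exists2 x, Z i.+1 x & ~ vanishes_at F x.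
    apply: zclosed_proper cC _ => ZC; have [_] := Zlt i im; apply=> z Zz.
    have [[C' _ Z'E] _] := Zc i.+1 im; rewrite ZE; split; last exact: ZC.
    by move: Zz; rewrite Z'E => -[].
  have hF' : homogeneous F by exists D.
  exists (F, D); split=> //=; last by exists z.
    rewrite lt0n; apply/eqP => D0; apply: Fz.
    have [v yv] := hcoords_ex y; have [w zw] := hcoords_ex z.
    rewrite (vanishesE hF' zw) -[F.@[_]]mul1r -(expr0 0) -{1}D0 -(homog_scale 0 w hF).
    rewrite scale0r -(scale0r v) (homog_scale 0 v hF).
    have /CF : C y by move: Zy; rewrite ZE => -[].
    by rewrite (vanishesE hF' yv) => ->; rewrite mulr0.
  by move=> _ [<-] t; rewrite ZE => -[_]; apply: CF.
have [f fE] := choice Fex.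
pose D := (\prod_i (f i).2)%N.
have Dd i : ((f i).2 * (D %/ (f i).2) = D)%N.
  by rewrite mulnC divnK // /D (bigD1 i) //= dvdn_mulr.
have D0 : (0 < D)%N by rewrite prodn_gt0 // => i; case: (fE i).
pose H i := (f (inord i)).1 ^+ (D %/ (f (inord i)).2)%N.
have Hvan i x : vanishes_at (H i) x <-> vanishes_at (f (inord i)).1 x.
  have [D1 hf _ _] := fE (inord i); have [v xv] := hcoords_ex x.
  have hf' : homogeneous (f (inord i)).1 by eexists; apply: hf.
  have hH : homogeneous (H i) by eexists; exact: dhomogMn hf.
  rewrite (vanishesE hH xv) (vanishesE hf' xv) /H rmorphXn /=.
  split=> [/eqP|->]; first by rewrite expf_eq0 => /andP[_ /eqP].
  by rewrite expr0n eqn0Ngt divn_gt0 // dvdn_leq // -(Dd (inord i)) dvdn_mulr.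
exists H, D; split=> [i|i im x Zx|i im].
- by have [_ hf _ _] := fE (inord i); rewrite -(Dd (inord i)) dhomogMn.
- have [_ _ + _] := fE (inord i.+1).
  by rewrite Hvan; apply; first by rewrite inordK.
- have [_ _ _ [x]] := fE (inord i); rewrite inordK // => Zx fx; exists x => //.
  by rewrite Hvan.
Qed.

(** The monomials in [m + 1] forms attached to a chain of length [m] are linearly
    independent; those considered are [s ^ m] in number and of degree [m s D],
    while the forms of this degree in [d + 1] variables have dimension at most
    [(m s D + 1) ^ d]. The value of [s] makes this impossible for [m > d]. *)
Lemma chain_bound m Z : irreducible_chain S m Z -> (m <= d)%N.
Proof.
move=> ch; have [H [D [hH Hv Hn]]] := chain_forms ch; have [Zc Zlt] := ch.
rewrite leqNgt; apply/negP => dm.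
pose s := ((m * D).+1 ^ d).+1; pose e := (m * s)%N.
have lt_n : ((D * e).+1 ^ d < s ^ m)%N.
  apply: (@leq_trans (s ^ d.+1)); last by rewrite leq_pexp2l.
  apply: (@leq_ltn_trans (((m * D).+1 * s) ^ d)%N).
    case: (d) => // d'; rewrite leq_exp2r // /e; nia.
  by rewrite expnMn expnS ltn_pmul2r // expn_gt0.
have [|c [[i im ci] c0]] :=
  @forms_dependent (s ^ m) (D * e) (fun code => coded_mon H s m code e) lt_n.
  by move=> i im; apply: coded_mon_homog.
move/eqP: ci; apply; apply: (coded_mon_free hH _ _ _ Hv Hn (e := e) _ _ _ im) => //.
- by move=> l lm; case: (Zc l lm).
- by move=> l lm; case: (Zlt l lm).
- move=> x Zx; apply: c0; have [[C _ ZE] _] := Zc m (leqnn m).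
  by move: Zx; rewrite ZE => -[].
Qed.

End Dimension.

Lemma has_dim_unique (k : fieldType) (k0 : [pchar k] =i pred0) (N d : nat)
    (b : 'Hom('rV[k]_d.+1, 'rV[k]_N.+1)) (S : set (ppoint k N)) delta :
  lker b == 0%VS -> (forall p, S p -> (pline p <= limg b)%VS) ->
  (forall (u : 'rV[k]_d.+1) p, (forall c, u 0 c != 0) -> hcoords p (b u) -> S p) ->
  has_dim S delta -> delta = d.
Proof.
move=> b_inj S_sub S_torus [[Z ch] bound]; apply/eqP; rewrite eqn_leq.
rewrite (chain_bound S_sub ch) /=; have [Z' ch'] := flag_chain k0 b_inj S_torus.
exact: bound ch'.
Qed.

(** * The projective embedding *)

Section Embedding.
Variables (k : fieldType) (k0 : [pchar k] =i pred0).

Lemma pimage_comp (n p q : nat) (f : 'Hom('rV[k]_n.+1, 'rV[k]_p.+1))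
    (h : 'Hom('rV[k]_p.+1, 'rV[k]_q.+1)) (Y : set (ppoint k n)) :
  lker f == 0%VS -> pimage h (pimage f Y) = pimage (h \o f)%VF Y.
Proof.
move=> f_inj; apply/seteqP; split=> y.
  by move=> [z [x Yx zx] yz]; exists x => //; rewrite yz zx limg_comp.
move=> [x Yx yx]; have [v xv] := hcoords_ex x.
have fv0 := inj_neq0 f_inj (hcoords_neq0 xv).
exists (ppt fv0); first by exists x => //; rewrite xv limg_line.
by rewrite yx xv !limg_line comp_lfunE.
Qed.

(** Distinct characters are linearly independent, so that [X_A] spans its
    ambient space. Hence the ambient space of [X_A] embeds in that of [X]. *)
Lemma toric_X_span (M : zmodType) (M_free : free_of_finite_rank M) m
    (A : 'I_m.+1 -> M) (K : {vspace 'rV[k]_m.+1}) : injective A ->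
  (forall t, torus_point setT t -> torus_vec A predT t \in K) -> K = fullv.
Proof.
move=> A_inj AK; apply/vspaceP => v; rewrite memvf; apply/equationsP/rowP => i.
rewrite mxE lfun_row big1 // => l _; set F := lin_form (equations K) i.
have <- : F@_U_(l) = equations K (delta_mx 0 l) 0 i.
  rewrite raddf_sum (bigD1 l) //= big1 ?addr0 => [|j jl].
    by rewrite mcoeffZ mcoeffXU eqxx mulr1.
  by rewrite mcoeffZ mcoeffXU (negbTE jl) mulr0.
have hF : homogeneous F by exists 1%N; apply: lin_form_homog.
have phiI : toric_invariant A (fun a => (a == U_(l)%MM)%:R : k).
  have W j : weight A U_(j)%MM = A j.
    rewrite /weight (bigD1 j) //= mnm1E eqxx big1 ?addr0 // => j' jj'.
    by rewrite mnm1E eq_sym (negbTE jj').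
  have one a b : toric_eqv A a b -> a = U_(l)%MM -> b = U_(l)%MM.
    move=> [ab wab] aE; move: ab wab; rewrite aE mdeg1 => /esym/eqP.
    by rewrite mdeg_eq1 => /existsP[j /eqP ->]; rewrite !W => /A_inj ->.
  move=> a b ab; congr (_%:R); congr nat_of_bool; apply/eqP/eqP; first exact: one ab.
  by apply: one; case: ab => ? ?; split.
have F0 t : torus_point setT t -> F.@[torus_vec A predT t 0] = 0.
  by move=> /AK/equationsP tK; rewrite lin_formE tK mxE.
have := toric_vanish k0 M_free hF F0 phiI.
have [lF|] := boolP (U_(l)%MM \in msupp F).
  rewrite (bigD1_seq _ lF) ?msupp_uniq //= eqxx mulr1 big1 ?addr0 => [->|a al].
    by rewrite mulr0.
  by rewrite (negbTE al) mulr0.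
by rewrite -mcoeff_eq0 => /eqP -> _; rewrite mulr0.
Qed.

Lemma embedding_factor N (X : set (ppoint k N)) (E : toric_embedding X) :
  exists g : 'Hom('rV[k]_(te_m E).+1, 'rV[k]_N.+1),
    [/\ lker g == 0%VS, (te_j1 E \o g)%VF = te_j2 E & X = pimage g (toric_X (te_A E))].
Proof.
case: E => M M_free m A A_inj N' j1 j2 j1_inj j2_inj equiv /=.
pose K := (j2 @^-1: limg j1)%VS.
have Kfull : K = fullv.
  apply: (toric_X_span M_free A_inj) => t tt.
  have tv0 := torus_neq0 A tt; have jt0 := inj_neq0 j2_inj tv0.
  have : pimage j2 (toric_X A) (ppt jt0).
    apply/pimageP; exists (ppt tv0), (torus_vec A predT t); split=> //.
    by apply: subset_zclosure; exists t.
  rewrite -equiv => /pimageP[x [v [_ xv jv]]]; rewrite -memv_preim memvE.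
  by move: jv; rewrite /hcoords /= => ->; rewrite -memvE memv_img ?memvf.
pose g := (j1^-1 \o j2)%VF.
have gE v : j1 (g v) = j2 v.
  by rewrite comp_lfunE limg_lfunVK // memv_preim -/K Kfull memvf.
exists g; split.
- apply/lker0P => u v uv; apply: (lker0P j2_inj); by rewrite -!gE uv.
- by apply/lfunP => v; rewrite comp_lfunE gE.
apply/seteqP; split=> x.
  move=> Xx; have [v xv] := hcoords_ex x.
  have jv0 := inj_neq0 j1_inj (hcoords_neq0 xv).
  have : pimage j1 X (ppt jv0) by apply/pimageP; exists x, v.
  rewrite equiv => /pimageP[p [w [Tp pw jw]]]; apply/pimageP; exists p, w; split=> //.
  have [a a0 jE] := hcoords_uniq jw (hcoords_ppt jv0).
  have vE : v = a *: g w by apply: (lker0P j1_inj); rewrite linearZ /= gE.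
  have := hcoordsZ (invr_neq0 a0) xv.
  by rewrite vE scalerA mulVf // scale1r.
move=> /pimageP[p [w [Tp pw xw]]].
have jw0 := inj_neq0 j2_inj (hcoords_neq0 pw).
have : pimage j2 (toric_X A) (ppt jw0) by apply/pimageP; exists p, w.
rewrite -equiv => /pimageP[y [v [Xy yv jv]]]; suff -> : x = y by [].
have [a a0 vE] := hcoords_uniq (hcoords_ppt jw0) jv.
apply: hcoords_inj yv; rewrite (_ : v = a *: g w); first exact: hcoordsZ.
by apply: (lker0P j1_inj); rewrite linearZ /= gE.
Qed.

End Embedding.

(** * The Gauss fibers and the join *)

Section JoinDecomposition.
Variables (k : fieldType) (k0 : [pchar k] =i pred0).
Variables (M : zmodType) (M_free : free_of_finite_rank M).
Variables (m : nat) (A : 'I_m.+1 -> M).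
Variables (N : nat) (g : 'Hom('rV[k]_m.+1, 'rV[k]_N.+1)) (g_inj : lker g == 0%VS).
Local Notation X := (pimage g (toric_X A)).

(** The torus is dense in [X_A], and closed sets pull back to closed sets. *)
Lemma orbit_dense (C : set (ppoint k N)) : zclosed C ->
  (forall t, torus_point setT t -> forall p, hcoords p (g (torus_vec A predT t)) -> C p) ->
  X `<=` C.
Proof.
move=> cC tC q /pimageP[x [v [+ xv qv]]].
move=> /(_ _ (conj (zclosed_preimage g_inj cC) _)) H.
apply: (H _ q v) => // y [t tt yt] p w yw pw.
have [a a0 wE] := hcoords_uniq yt yw.
apply: (tC t tt); have := hcoordsZ (invr_neq0 a0) pw.
rewrite wE linearZ scalerA mulVf // scale1r /=.
by congr (hcoords _ (g _)); apply/rowP => i; rewrite !mxE.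
Qed.

Variables (d : nat) (kap : 'I_m.+1 -> 'I_d.+1).
Local Notation blk c := [pred i | kap i == c].
Hypothesis kap_surj : forall c, exists i, kap i = c.
Hypothesis split : forall (c : 'I_d.+1) a b,
  toric_eqv A a b -> toric_eqv A (mrestr (blk c) a) (mrestr (blk c) b).

Section GaussFiber.
Hypothesis multiplierE : forall z : 'rV[k]_m.+1, multiplier A z <->
  exists u : 'rV[k]_d.+1, forall i, z 0 i = u 0 (kap i).
Variables (x : 'rV[k]_m.+1).
Hypotheses (x_cone : toric_cone A predT x) (x_neq0 : forall i, x 0 i != 0).

Definition fiber_param : 'Hom('rV[k]_d.+1, 'rV[k]_N.+1) :=
  (g \o linfun (mulmxr (\matrix_(c, i) (if kap i == c then x 0 i else 0))))%VF.

Lemma fiber_paramE u : fiber_param u = g (block_scale kap u x).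
Proof.
rewrite comp_lfunE lfunE /=; congr (g _); apply/rowP => i.
rewrite !mxE (bigD1 (kap i)) //= mxE eqxx big1 ?addr0 // => c ci.
by rewrite mxE eq_sym (negbTE ci) mulr0.
Qed.

Lemma fiber_param_inj : lker fiber_param == 0%VS.
Proof.
apply/lker0P => u v; rewrite !fiber_paramE => /(lker0P g_inj)/rowP uv.
apply/rowP => c; have [i <-] := kap_surj c.
by have := uv i; rewrite !mxE => /(mulIf (x_neq0 i)).
Qed.

(** The tangent space at a point [y] of [X] contains the product of [y] and the
    row space, with equality on the torus. So it is the same as at [x] only if
    the quotient of [y] by [x] is a multiplier of the row space. *)
Lemma gauss_fiber_sub p q T : hcoords p (g x) ->
  gauss_map X p T -> gauss_map X q T -> (pline q <= limg fiber_param)%VS.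
Proof.
move=> px [_ /(tangent_spaceP _ _ _ px) Tx _] [Xq Tq _].
have [y qy y_cone] := (pimage_toricP k0 M_free A g q).1 Xq.
move/(tangent_spaceP _ _ _ qy): Tq => Ty.
pose z : 'rV[k]_m.+1 := \row_i (y 0 i / x 0 i).
have /multiplierE[u zu] : multiplier A z.
  move=> w hw; have /Ty/Tx := tangent_orbit k0 M_free g_inj y_cone hw.
  move=> /(tangent_torus k0 M_free g_inj x_cone x_neq0)[w' hw' /(lker0P g_inj) E].
  have -> // : had z w = w'.
  apply/rowP => i; have /rowP/(_ i) := E; rewrite !mxE => Ei.
  by apply: (mulfI (x_neq0 i)); rewrite -Ei mulrA [x 0 i * _]mulrC divfK.
rewrite qy -memvE; suff -> : g y = fiber_param u by rewrite memv_img ?memvf.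
rewrite fiber_paramE; congr (g _); apply/rowP => i.
by rewrite !mxE -zu mxE divfK.
Qed.

Lemma gauss_fiber_torus p q T (u : 'rV[k]_d.+1) : hcoords p (g x) -> gauss_map X p T ->
  (forall c, u 0 c != 0) -> hcoords q (fiber_param u) -> gauss_map X q T.
Proof.
move=> px [_ /(tangent_spaceP _ _ _ px) Tx dimT] u0; rewrite fiber_paramE.
set y := block_scale kap u x => qy.
have y_cone : toric_cone A predT y by apply: toric_cone_scale.
have y0 i : y 0 i != 0 by rewrite !mxE mulf_neq0.
split=> //; first by apply/(pimage_toricP k0 M_free); exists y.
apply/(tangent_spaceP _ _ _ qy) => v; split.
  move=> /Tx/(tangent_torus k0 M_free g_inj x_cone x_neq0)[w hw ->].
  pose z : 'rV[k]_m.+1 := \row_i (u 0 (kap i))^-1.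
  have -> : had x w = had y (had z w).
    by apply/rowP => i; rewrite !mxE [u 0 _ * _]mulrC -mulrA mulVKf.
  apply: (tangent_orbit k0 M_free g_inj y_cone).
  suff /(_ _ hw) : multiplier A z by [].
  by apply/multiplierE; exists (\row_c (u 0 c)^-1) => i; rewrite !mxE.
move=> /(tangent_torus k0 M_free g_inj y_cone y0)[w hw ->]; apply/Tx.
rewrite /y /block_scale -hadA hadC -hadA; apply: (tangent_orbit k0 M_free g_inj x_cone).
rewrite hadC; suff /(_ _ hw) : multiplier A (\row_i u 0 (kap i)) by [].
by apply/multiplierE; exists u => i; rewrite mxE.
Qed.

Lemma gauss_fiber_dim Y p T delta : Y = X -> hcoords p (g x) -> gauss_map Y p T ->
  has_dim [set q | gauss_map Y q T] delta -> delta = d.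
Proof.
move=> -> px Tp; apply: (has_dim_unique k0 fiber_param_inj) => [q|u q].
  exact: gauss_fiber_sub px Tp.
exact: gauss_fiber_torus px Tp.
Qed.

End GaussFiber.

Definition piece (c : 'I_d.+1) : set (ppoint k N) := pimage g (toric_set A (blk c)).

Lemma pieceP c q : piece c q <-> exists2 v, hcoords q (g v) & toric_cone A (blk c) v.
Proof.
split=> [/pimageP[x [v [xA xv qv]]]|[v qv hv]].
  by exists v => //; apply: xA.
have v0 : v != 0.
  by apply: contraNneq (hcoords_neq0 qv) => ->; rewrite linear0.
apply/pimageP; exists (ppt v0), v; split=> //.
by apply/(toric_setP _ _ (hcoords_ppt v0)).
Qed.

Lemma torus_restr_cone c t : torus_point setT t ->
  toric_cone A (blk c) (torus_vec A (blk c) t : 'rV[k]_m.+1) /\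
  torus_vec A (blk c) t != 0 :> 'rV[k]_m.+1.
Proof.
move=> tt; split.
  have -> : torus_vec A (blk c) t = vrestr (blk c) (torus_vec A predT t).
    by apply/rowP => i; rewrite !mxE.
  exact/(toric_cone_restr split)/torus_cone.
have [i ic] := kap_surj c; apply/eqP => /rowP/(_ i); rewrite !mxE /= ic eqxx => /eqP.
by rewrite (negbTE (torus_point_neq0 _ tt)).
Qed.

(** A piece is the closure of the orbit of the torus points whose coordinates
    outside the block are replaced by [0]. *)
Lemma piece_variety c : projective_variety (piece c).
Proof.
split; first by apply: (zclosed_pimage g_inj); apply: zclosed_toric_set.
have tP t : torus_point setT t ->
    exists2 p, piece c p & hcoords p (g (torus_vec A (blk c) t)).
  move=> /(torus_restr_cone c)[hc t0]; have gt0 := inj_neq0 g_inj t0.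
  exists (ppt gt0); last exact: hcoords_ppt.
  by apply/pieceP; exists (torus_vec A (blk c) t).
apply/zirreducibleP; split.
  by have [|p] := @tP (fun=> 1); [split=> // *; rewrite mulr1|exists p].
move=> F G hF hG FG.
have [|F0|G0] := @toric_prime _ k0 _ M_free _ A (pullback g F) (pullback g G) (blk c)
    (homogeneous_pullback _ hF) (homogeneous_pullback _ hG).
- move=> t /tP[p /FG FGp pt]; rewrite mevalM !pullbackE -mevalM.
  by apply/(vanishesE (homogeneousM hF hG) pt).
- by left=> p /pieceP[v pv hv]; apply/(vanishesE hF pv); rewrite -pullbackE F0.
- by right=> p /pieceP[v pv hv]; apply/(vanishesE hG pv); rewrite -pullbackE G0.
Qed.

Lemma piece_sub c : piece c `<=` X.
Proof.
move=> p /pieceP[v pv [_ vI]]; apply/(pimage_toricP k0 M_free); exists v => //.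
Qed.

Lemma piece_disjoint c c' : c != c' -> piece c `&` piece c' = set0.
Proof.
move=> cc'; apply/seteqP; split=> // p [/pieceP[v pv [vc _]] /pieceP[w pw [wc _]]].
have [a a0 /esym] := hcoords_uniq pv pw; rewrite -linearZ => /(lker0P g_inj) E.
have /eqP := hcoords_neq0 pv; apply; suff -> : v = 0 by rewrite linear0.
apply/rowP => i; rewrite mxE; have [ic|/vc //] := boolP (blk c i).
apply: (mulfI a0); rewrite mulr0; have /rowP/(_ i) := E; rewrite mxE => ->.
by apply: wc; move: ic => /= /eqP ->.
Qed.

(** A torus point is the sum of its restrictions to the blocks, and a sum of
    points of the cones over the pieces is glued from its restrictions. *)
Lemma join_pieces : zclosed X -> X = join piece.
Proof.
move=> cX; apply/seteqP; split.
  apply: orbit_dense; first exact: zclosed_zclosure.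
  move=> t tt p pt; apply: subset_zclosure.
  have [hc t0] := all_and2 (fun c => torus_restr_cone c tt).
  exists (fun c => ppt (inj_neq0 g_inj (t0 c))).
    by move=> c; apply/pieceP; exists (torus_vec A (blk c) t).
  have -> : pline p = <[\sum_c g (torus_vec A (blk c) t)]>%VS.
    rewrite pt -linear_sum; congr (<[g _]>)%VS; apply/rowP => i.
    rewrite summxE (bigD1 (kap i)) //= !mxE /= eqxx big1 ?addr0 // => c ci.
    by rewrite mxE /= eq_sym (negbTE ci).
  by rewrite -memvE memv_sumr // => c _; apply: memv_line.
apply: zclosure_sub => // p [x /= xY].
have [w pw] := hcoords_ex p; rewrite pw -memvE => /memv_sumP[y yx wE].
have ex c : exists v, y c = g v /\ toric_cone A (blk c) v.
  have /pieceP[v xv hv] := xY c.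
  have := yx c isT; rewrite xv => /vlineP[a ->]; exists (a *: v).
  by rewrite linearZ; split=> //; apply: toric_coneZ.
have [v vP] := choice ex; apply/(pimage_toricP k0 M_free); exists (\sum_c v c).
  by rewrite /hcoords linear_sum pw wE; congr (<[_]>)%VS; apply: eq_bigr => c _; case: (vP c).
apply: (toric_cone_glue split) => c; have [_ vc] := vP c.
suff -> : vrestr (blk c) (\sum_c v c) = v c by [].
apply/rowP => i; rewrite mxE /= summxE; case: eqP => [ic|/eqP ic].
  rewrite (bigD1 c) //= big1 ?addr0 // => c' cc'.
  by have [_ [-> //]] := vP c'; rewrite /= ic eq_sym.
by case: vc => ->.
Qed.

(** The torus acts on monomials of the same class by the same character. *)
Lemma piece_torus_stable c (s : M -> k) : torus_point (diff_subgroup A) s ->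
  forall x y, toric_set A (blk c) x -> torus_act A s x y -> toric_set A (blk c) y.
Proof.
move=> hs x y xc [v xv ys]; apply/(toric_setP _ _ ys).
have [vc vI] := (toric_setP _ _ xv).1 xc.
split=> [i ci|a b ab]; first by rewrite mxE vc ?mulr0.
have H0 : diff_subgroup A 0 by move=> H [].
have HD (u w : M) : diff_subgroup A u -> diff_subgroup A w -> diff_subgroup A (u + w).
  move=> hu hw H hH; have [H0' HB _] := hH.
  have Hw : H (- w) by rewrite -[- w]add0r; apply: (HB) => //; apply: hw.
  by rewrite -[w]opprK; apply: (HB) => //; apply: hu.
have HA i : diff_subgroup A (A i - A ord0) by move=> H [_ _]; apply.
have E e : mon (\row_i (s (A i - A ord0) * v 0 i)) e =
    s (weight A e - A ord0 *+ mdeg e) * mon v e.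
  rewrite /mon; under eq_bigr do rewrite mxE exprMn.
  rewrite big_split /= (torus_point_weight _ hs) //; congr (s _ * _).
  rewrite /weight mdegE -sumrMnr -sumrB; apply: eq_bigr => i _.
  by rewrite mulrnBl.
by rewrite !E (vI _ _ ab); case: ab => -> ->.
Qed.

End JoinDecomposition.

Theorem corollary1p3 (k : closedFieldType) (hk : [pchar k] =i pred0)
  (N : nat) (X : set (ppoint k N)) (hX : projective_variety X)
  (E : toric_embedding X) (delta : nat) (hdelta : gauss_defect X delta) :
  exists Y : 'I_delta.+1 -> set (ppoint k N),
    [/\ forall i, projective_variety (Y i) /\ Y i `<=` X,
        forall i, torus_invariant E (Y i),
        forall i j, i != j -> Y i `&` Y j = set0 &
        X = join Y].
Proof.
have [g [g_inj gE XE]] := embedding_factor hk E.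
have M_free := te_free E.
have [d [kap [kap_surj split multE]]] := splitting hk M_free (te_A E).
have [U [[C cC UE] [p0 Up0] hU]] := hdelta.
have [t tt [p pt Cp]] : exists2 t, torus_point setT t &
    exists2 p, hcoords p (g (torus_vec (te_A E) predT t)) & ~ C p.
  apply: contrapT => nt; move: Up0; rewrite UE XE => -[Xp0]; apply.
  apply: (orbit_dense g_inj cC _ Xp0) => t tt p pt; apply: contrapT => Cp.
  by apply: nt; exists t => //; exists p.
have x_cone : toric_cone (te_A E) predT (torus_vec (te_A E) predT t) by apply: torus_cone.
have x0 i : torus_vec (te_A E) predT t 0 i != 0 :> k by rewrite mxE torus_point_neq0.
have [|T Tp hdim] := hU p.
  rewrite UE; split=> //; rewrite XE; apply/(pimage_toricP hk M_free).
  by exists (torus_vec (te_A E) predT t).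
have dE := gauss_fiber_dim hk M_free g_inj kap_surj split multE x_cone x0 XE pt Tp hdim.
subst delta; exists (piece (te_A E) g kap); split=> [c|c|c c' cc'|].
- split; first exact: (piece_variety hk M_free g_inj kap_surj split).
  by apply: (subset_trans (@piece_sub _ hk _ M_free _ _ _ _ _ _ c)); rewrite -XE.
- exists (toric_set (te_A E) [pred i | kap i == c]); split.
  + rewrite (toric_X_E hk M_free) => x xc v xv.
    by have [_ vI] := xc v xv; split.
  + by rewrite -gE; apply: pimage_comp.
  + by move=> s hs x y; apply: piece_torus_stable.
- exact: piece_disjoint.
rewrite {1}XE; apply: (join_pieces hk M_free g_inj kap_surj split).
by rewrite -XE; case: hX.
Qed.
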